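(* Let $\bar\varepsilon\in\mathcal{U}_e$ be given and let $\mathcal{N}:\mathcal{E}_0\to\mathbb{R}$ be defined by $\mathcal{N}(e^* )=\frac12\|\Gamma_0L(\bar\varepsilon+e^* )\|^2_{\mathcal{H}_e}$. The gradient of $\mathcal{N}$ at $e^*\in\mathcal{E}_0$, in $\mathcal{E}_0$ endowed with the energetic scalar product $(\cdot,\cdot)_{\mathcal{H}_e}$, is the element of $\mathcal{E}_0$ given by $$\nabla\mathcal{N}(e^* )=\Gamma_0L\,\Gamma_0L(\bar\varepsilon+e^* ).$$
   Context: Let $\mathcal{V}\subset\mathbb{R}^d$ be a unit cell that tiles $\mathbb{R}^d$ by translation along a lattice $\mathcal{R}$ generated by $d$ vectors. ''Periodic'' means $\mathcal{R}$-periodic. $L^2_{\mathrm{per}}(\mathcal{V})$ is the space of periodic functions in $L^2_{\mathrm{loc}}(\mathbb{R}^d)$, and $H^1_{\mathrm{per}}(\mathcal{V})$ the space of periodic functions in $H^1_{\mathrm{loc}}(\mathbb{R}^d)$. All fields are real-valued. Write $\langle f\rangle=\frac1{|\mathcal{V}|}\int_{\mathcal{V}}f\,dx$ and $s:e=\sum_{i,j}s_{ij}e_{ij}$. $L_0$ is a uniform (constant in $x$) positive definite fourth-order tensor with major and minor symmetries; it acts on second-order tensors, $(L_0\eta)_{ij}=\sum_{k,l}(L_0)_{ijkl}\eta_{kl}$, and it is thus an invertible, symmetric positive definite linear map on symmetric $d\times d$ matrices. $L=L(x)$ is the periodic fourth-order elasticity tensor field of the composite, with major and minor symmetries, components in $L^\infty(\mathcal{V})$,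 and uniformly positive definite (there is $\mu>0$ with $L(x)e:e\ge\mu\, e:e$ for a.e. $x$ and all symmetric $e$); it acts pointwise, $(L\eta)(x)=L(x)\eta(x)$. $\mathcal{H}_e$ (strain fields) is the space of symmetric second-order tensor fields with components in $L^2_{\mathrm{per}}(\mathcal{V})$, with scalar product $(\eta,\tilde\eta)_{\mathcal{H}_e}=\langle L_0\eta:\tilde\eta\rangle$ and associated norm $\|\cdot\|_{\mathcal{H}_e}$. $\mathcal{H}_s$ (stress fields) is the same set of tensor fields, with scalar product $(\tau,\tilde\tau)_{\mathcal{H}_s}=\langle\tau:L_0^{-1}\tilde\tau\rangle$. $\mathcal{U}_e\subset\mathcal{H}_e$ is the subspace of uniform (constant) fields. $\mathcal{E}_0=\{e^*\in\mathcal{H}_e:\ \exists\,w^*\in H^1_{\mathrm{per}}(\mathcal{V})^d,\ e^*=\frac12(\nabla w^*+(\nabla w^* )^{\top})\}$. $\mathcal{S}$ is the space of $s\in\mathcal{H}_s$ such that $\operatorname{div}s=0$ in $\mathcal{V}$ and $s\cdot n$ is anti-periodic on $\partial\mathcal{V}$ ($n$ the unit outward normal), i.e. the periodic field $s$ is divergence-free on $\mathbb{R}^d$ in the sense of distributions. The strain Green's operator $\Gamma_0:\mathcal{H}_s\to\mathcal{H}_e$ associated with $L_0$ is defined by $\Gamma_0\tau=e^*$, where $e^*$ is the unique element of $\mathcal{E}_0$ such that $L_0e^*-\tau\in\mathcal{S}$. The gradient $\nabla\mathcal{N}(e^* )$ is the element of $\mathcal{E}_0$ such that $(\nabla\mathcal{N}(e^*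 ),\tilde e^* )_{\mathcal{H}_e}=\lim_{t\to0}\frac{\mathcal{N}(e^*+t\tilde e^* )-\mathcal{N}(e^* )}{t}$ for all $\tilde e^*\in\mathcal{E}_0$. *)

(* Defs.v *)
From HB Require Import structures.
From mathcomp Require Import all_boot all_order all_algebra.
From mathcomp Require Import all_classical all_reals all_analysis.
Import numFieldNormedType.Exports.
Set Implicit Arguments.
Unset Strict Implicit.
Unset Printing Implicit Defensive.
Import Order.TTheory GRing.Theory Num.Theory.
Local Open Scope classical_set_scope.
Local Open Scope ring_scope.

Definition rV_display : measure_display -> measure_display.
Proof. exact. Qed.

(* The sigma-algebra on 'rV[R]_n is generated by the coordinates, hence is the
   Borel sigma-algebra of R^n. *)
Section measurable_rV.
Variables (R : realType) (n : nat).

Let coors : 'I_n -> 'rV[R]_n -> measurableTypeR R := fun i x => x 0 i.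

Let rV_set0 : g_sigma_preimage coors set0.
Proof. exact: sigma_algebra0. Qed.

Let rV_setC A : g_sigma_preimage coors A -> g_sigma_preimage coors (~` A).
Proof. exact: sigma_algebraC. Qed.

Let rV_bigcup (F : (set 'rV[R]_n)^nat) :
  (forall i, g_sigma_preimage coors (F i)) ->
  g_sigma_preimage coors (\bigcup_i (F i)).
Proof. exact: sigma_algebra_bigcup. Qed.

HB.instance Definition _ := @isMeasurable.Build
  (rV_display default_measure_display) 'rV[R]_n
  (g_sigma_preimage coors) rV_set0 rV_setC rV_bigcup.

End measurable_rV.

Lemma measurable_fun_rVP (R : realType) (n : nat) d (T : measurableType d)
    (f : T -> 'rV[R]_n) :
  measurable_fun setT f <->
  forall i, measurable_fun setT (fun x => f x 0 i : measurableTypeR R).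
Proof.
pose coors : 'I_n -> 'rV[R]_n -> measurableTypeR R := fun i x => x 0 i.
apply: (@iff_trans _ (g_sigma_preimage (fun i => coors i \o f) `<=` measurable)).
  rewrite g_sigma_preimage_comp; split=> [mf A [/= C preC <-]|prefS].
    exact: mf.
  by move=> _ A mA; apply: prefS; exists A.
rewrite {}/coors; split=> [fS i|mf].
- move=> _ A mA.
  apply: fS; apply: sub_sigma_algebra.
  case: n i => [[] []//|n i] in f *.
  rewrite -bigcup_mkord_ord.
  exists i; first exact: ltn_ord.
  by exists A => //; rewrite inord_val.
- apply: smallest_sub; first exact: sigma_algebra_measurable.
  case: n => [|n] in f mf *; first by rewrite big_ord0.
  rewrite -bigcup_mkord_ord; apply: bigcup_sub => i Ii.
  by move=> A [B mB <-]; exact: mf.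
Qed.

Section lebesgue_measure_rV.
Variable R : realType.

Definition cons_rV n (p : measurableTypeR R * 'rV[R]_n) : 'rV[R]_n.+1 :=
  row_mx (const_mx p.1 : 'rV_1) p.2.

Lemma cons_rV0 n (p : measurableTypeR R * 'rV[R]_n) : cons_rV p 0 ord0 = p.1.
Proof.
rewrite /cons_rV (_ : ord0 = lshift n (ord0 : 'I_1)); last exact/val_inj.
by rewrite (@row_mxEl _ 1 1 n) mxE.
Qed.

Lemma cons_rV_lift n (p : measurableTypeR R * 'rV[R]_n) i :
  cons_rV p 0 (lift ord0 i) = p.2 0 i.
Proof.
rewrite /cons_rV (_ : lift ord0 i = rshift 1 i); last exact/val_inj.
by rewrite (@row_mxEr _ 1 1 n).
Qed.

Lemma measurable_coord n (i : 'I_n) :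
  measurable_fun setT (fun x : 'rV[R]_n => x 0 i : measurableTypeR R).
Proof. exact: (measurable_fun_rVP (@id 'rV[R]_n)).1. Qed.

Lemma measurable_cons_rV n : measurable_fun setT (@cons_rV n).
Proof.
apply/measurable_fun_rVP => i; case: (unliftP ord0 i) => [j|] ->.
- under eq_fun do rewrite cons_rV_lift.
  exact: (measurableT_comp (measurable_coord j) measurable_snd).
- under eq_fun do rewrite cons_rV0.
  exact: measurable_fst.
Qed.

Lemma measurable_head_tail n :
  measurable_fun setT (fun x : 'rV[R]_n.+1 =>
    (x 0 ord0 : measurableTypeR R, \row_j x 0 (lift ord0 j) : 'rV[R]_n)).
Proof.
apply: measurable_fun_pair; first exact: measurable_coord.
apply/measurable_fun_rVP => i.
by under eq_fun do rewrite mxE; exact: measurable_coord.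
Qed.

Section step.
Variables (n : nat) (mu : {sigma_finite_measure set 'rV[R]_n -> \bar R}).

Definition cons_measure : set 'rV[R]_n.+1 -> \bar R :=
  pushforward (@lebesgue_measure R \x mu)%E (@cons_rV n).

Let cons_measure0 : cons_measure set0 = 0%E.
Proof. by rewrite /cons_measure /pushforward preimage_set0 measure0. Qed.

Let cons_measure_ge0 A : (0 <= cons_measure A)%E.
Proof. exact: (measure_ge0 (@lebesgue_measure R \x mu)%E). Qed.

Let cons_measure_additive : semi_sigma_additive cons_measure.
Proof.
move=> F mF tF mUF; rewrite /cons_measure /pushforward preimage_bigcup.
apply: (@measure_semi_sigma_additive _ _ _ (@lebesgue_measure R \x mu)%E).
- by move=> k; rewrite -[X in measurable X]setTI; exact: measurable_cons_rV.
- apply/trivIsetP => /= i j _ _ ij; rewrite -preimage_setI.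
  by move/trivIsetP : tF => /(_ _ _ _ _ ij) ->//; rewrite preimage_set0.
- rewrite -preimage_bigcup -[X in measurable X]setTI.
  exact: measurable_cons_rV.
Qed.

HB.instance Definition _ := isMeasure.Build _ _ _ cons_measure
  cons_measure0 cons_measure_ge0 cons_measure_additive.

Let cons_measure_sigma_finite : sigma_finite setT cons_measure.
Proof.
have [F FT mF] := sigma_finiteT (@lebesgue_measure R).
have [G GT mG] := sigma_finiteT mu.
pose tl (x : 'rV[R]_n.+1) : 'rV[R]_n := \row_j x 0 (lift ord0 j).
have tlK p : tl (cons_rV p) = p.2.
  by apply/rowP => j; rewrite mxE cons_rV_lift.
have mF' k := (mF k).1; have mG' k := (mG k).1.
pose H k l : set 'rV[R]_n.+1 :=
  [set x : 'rV[R]_n.+1 | F k (x 0 ord0) /\ G l (tl x)].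
have HE k l : @cons_rV n @^-1` H k l = F k `*` G l.
  by apply/seteqP; split => p; rewrite /H /= cons_rV0 tlK.
exists (fun m => if unpickle m is Some (k, l) then H k l else set0) => [|m].
  apply/seteqP; split => // x _.
  have [k _ Fk] : (\bigcup_i F i) (x 0 ord0) by rewrite -FT.
  have [l _ Gl] : (\bigcup_i G i) (tl x) by rewrite -GT.
  by exists (pickle (k, l)) => //; rewrite pickleK.
case: unpickle => [[k l]|]; last by rewrite cons_measure0; split.
split.
  rewrite -[X in measurable X]setTI.
  exact: (measurable_head_tail measurableT (measurableX (mF' k) (mG' l))).
rewrite /cons_measure /pushforward HE product_measure1E//.
rewrite lte_mul_pinfty// ?ge0_fin_numE//; [exact: (mF k).2|exact: (mG l).2].
Qed.

HB.instance Definition _ := Measure_isSigmaFinite.Build _ _ _ cons_measure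
  cons_measure_sigma_finite.

End step.

(* n-dimensional Lebesgue measure, as the n-fold product of lebesgue_measure. *)
Fixpoint lebesgue_rV n : {sigma_finite_measure set 'rV[R]_n -> \bar R} :=
  match n with
  | 0 => dirac (0 : 'rV[R]_0)
  | n'.+1 => cons_measure (lebesgue_rV n')
  end.

Lemma lebesgue_rV_box n (a b : 'rV[R]_n) : (forall i, a 0 i <= b 0 i) ->
  lebesgue_rV n [set x : 'rV[R]_n | forall i, x 0 i \in `[a 0 i, b 0 i]] =
  (\prod_i (b 0 i - a 0 i))%:E.
Proof.
elim: n a b => [|n IH] a b ab.
  rewrite big_ord0 /= diracE mem_set//= => -[].
  by case.
rewrite big_ord_recl /= /cons_measure /pushforward.
pose tl (x : 'rV[R]_n.+1) : 'rV[R]_n := \row_j x 0 (lift ord0 j).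
have -> : @cons_rV n @^-1` [set x : 'rV[R]_n.+1 | forall i, x 0 i \in `[a 0 i, b 0 i]] =
    `[a 0 ord0, b 0 ord0]%classic `*`
    [set x : 'rV[R]_n | forall i, x 0 i \in `[tl a 0 i, tl b 0 i]].
  apply/seteqP; split => p /=.
    move=> h; split; first by have := h ord0; rewrite cons_rV0.
    by move=> i; have := h (lift ord0 i); rewrite cons_rV_lift !mxE.
  move=> [h0 h] i; case: (unliftP ord0 i) => [j|] ->.
    by rewrite cons_rV_lift; have := h j; rewrite !mxE.
  by rewrite cons_rV0.
rewrite product_measure1E//; last first.
  have -> : [set x : 'rV[R]_n | forall i, x 0 i \in `[tl a 0 i, tl b 0 i]] =
     \bigcap_i (if insub i is Some j then
        [set x : 'rV[R]_n | x 0 j \in `[tl a 0 j, tl b 0 j]] else setT).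
    apply/seteqP; split => x /=.
      by move=> h i _; case: insubP => // j _ _; exact: h.
    by move=> h i; have := h i I; rewrite insubT// => ?; rewrite (_ : Sub _ _ = i)//; exact/val_inj.
  apply: bigcapT_measurable => i; case: insubP => // j _ _.
  rewrite -[X in measurable X]setTI.
  exact: (measurable_coord j measurableT (measurable_itv `[tl a 0 j, tl b 0 j])).
transitivity ((b 0 ord0 - a 0 ord0)%:E *
    (\prod_i (tl b 0 i - tl a 0 i))%:E)%E; last first.
  by rewrite -EFinM; congr (_ * _)%:E; apply: eq_bigr => i _; rewrite !mxE.
congr (_ * _)%E; last by apply: IH => i; rewrite !mxE.
apply: (etrans (lebesgue_measure_itv `[a 0 ord0, b 0 ord0])).
rewrite /= lte_fin; case: ltP => //= h.
by rewrite (@le_anti _ _ (a 0 ord0) (b 0 ord0)) ?subrr// ab h.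
Qed.

End lebesgue_measure_rV.
Section lattice.
Variables (R : realType) (d : nat).
Implicit Types (B : 'M[R]_d) (V : set 'rV[R]_d).
Local Notation mu := (lebesgue_rV R d).

(* The rows of B are the generators. *)
Definition lattice B : set 'rV[R]_d :=
  [set map_mx intr z *m B | z in [set: 'rV[int]_d]].

(* The translates of V cover space and are disjoint, up to null sets (such as
   the boundary of the cell). *)
Definition unit_cell B V :=
  measurable V /\
  {ae mu, forall x, exists! r, lattice B r /\ V (x - r)}.

Definition periodic B (T : Type) (f : 'rV[R]_d -> T) :=
  forall r, lattice B r -> {ae mu, forall x, f (x + r) = f x}.

Definition average V (f : 'rV[R]_d -> R) : R :=
  (fine (mu V))^-1 * \int[mu]_(x in V) f x.

End lattice.

Section weak_derivatives.
Variables (R : realType) (d : nat).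
Implicit Types (B : 'M[R]_d) (f g phi : 'rV[R]_d -> R).
Local Notation mu := (lebesgue_rV R d).

Definition partial (i : 'I_d) phi : 'rV[R]_d -> R :=
  fun x => 'D_(delta_mx 0 i) phi x.

Fixpoint Cn (n : nat) phi : Prop :=
  continuous phi /\
  match n with
  | 0 => True
  | n'.+1 => forall i, (forall x, derivable phi x (delta_mx 0 i)) /\
                       Cn n' (partial i phi)
  end.

(* C^oo functions with compact support *)
Definition test_function phi :=
  (forall n, Cn n phi) /\
  (exists2 K, compact K & forall x, ~ K x -> phi x = 0).

Definition L2loc f :=
  measurable_fun setT f /\
  (forall K, compact K -> (\int[mu]_(x in K) ((f x) ^+ 2)%:E < +oo)%E).

Definition L2per B f := L2loc f /\ periodic B f.

Definition weak_partial (i : 'I_d) f g :=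
  forall phi, test_function phi ->
    \int[mu]_x (f x * partial i phi x) = - \int[mu]_x (g x * phi x).

Definition H1loc f :=
  L2loc f /\ forall i, exists2 g, L2loc g & weak_partial i f g.

Definition H1per B f := H1loc f /\ periodic B f.

Definition weak_gradient (w : 'rV[R]_d -> 'rV[R]_d) (W : 'rV[R]_d -> 'M[R]_d) :=
  forall i j, L2loc (fun x => W x i j) /\
    weak_partial j (fun x => w x 0 i) (fun x => W x i j).

End weak_derivatives.

Section tensors.
Variables (R : realType) (d : nat).

Definition ddot (s e : 'M[R]_d) : R := \sum_i \sum_j s i j * e i j.

Definition tensor4 := 'I_d -> 'I_d -> 'I_d -> 'I_d -> R.

Implicit Type C : tensor4.

Definition tapp C (e : 'M[R]_d) : 'M[R]_d :=
  \matrix_(i, j) \sum_k \sum_l C i j k l * e k l.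

Definition major_symmetry C := forall i j k l, C i j k l = C k l i j.

Definition minor_symmetries C :=
  forall i j k l, C i j k l = C j i k l /\ C i j k l = C i j l k.

Definition positive_definite C :=
  forall e : 'M[R]_d, e^T = e -> e != 0 -> 0 < ddot (tapp C e) e.

Definition reference_tensor C :=
  [/\ major_symmetry C, minor_symmetries C & positive_definite C].

End tensors.

Section fields.
Variables (R : realType) (d : nat).
Local Notation point := ('rV[R]_d).
Local Notation field := (point -> 'M[R]_d).
Local Notation mu := (lebesgue_rV R d).
Implicit Types (B : 'M[R]_d) (V : set point) (C : tensor4 R d)
  (L : point -> tensor4 R d) (G : field -> field).

Definition elasticity_field B V L :=
  [/\ forall i j k l, measurable_fun setT (fun x => L x i j k l),
      periodic B L,
      {ae mu, forall x, major_symmetry (L x) /\ minor_symmetries (L x)},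
      (exists M : R, {ae mu, forall x, V x ->
         forall i j k l, `|L x i j k l| <= M}) &
      (exists2 m : R, 0 < m & {ae mu, forall x, forall e : 'M[R]_d,
         e^T = e -> m * ddot e e <= ddot (tapp (L x) e) e})].

(* Elements of L^2 are represented by functions; two fields are the same element
   when they are equal almost everywhere.  All the sets of fields below are
   invariant under this equality among measurable fields. *)
Definition field_eq (e e' : field) := {ae mu, forall x, e x = e' x}.

(* The common underlying set of the strain and stress spaces H_e and H_s. *)
Definition Hspace B : set field := [set e : field |
  (forall i j, L2per B (fun x => e x i j)) /\
  {ae mu, forall x, (e x)^T = e x}].

Definition inner_He V C (e e' : field) : R :=
  average V (fun x => ddot (tapp C (e x)) (e' x)).

Definition norm_He V C (e : field) : R := Num.sqrt (inner_He V C e e).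

Definition Ue B : set field := [set e : field |
  Hspace B e /\ exists E : 'M[R]_d, field_eq e (cst E)].

Definition E0 B : set field := [set e : field |
  Hspace B e /\
  exists w : point -> point,
    (forall i, H1per B (fun x => w x 0 i)) /\
    exists2 W, weak_gradient w W &
      field_eq e (fun x => 2^-1 *: (W x + (W x)^T))].

(* Periodic stress fields that are divergence free in the sense of distributions
   on the whole space. *)
Definition Sspace B : set field := [set s : field |
  Hspace B s /\
  forall i phi, test_function phi ->
    \int[mu]_x (\sum_j s x i j * partial j phi x) = 0].

(* The element G tau is determined, up to a null set, by the two properties
   below. *)
Definition green_operator B C G :=
  forall tau, Hspace B tau ->
    E0 B (G tau) /\ Sspace B (fun x => tapp C (G tau x) - tau x).

Definition fapp L (e : field) : field := fun x => tapp (L x) (e x).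

Definition Nfun V C G L (eps e : field) : R :=
  2^-1 * norm_He V C (G (fapp L (fun x => eps x + e x))) ^+ 2.

(* g is the gradient at e of N : E0 -> R for the scalar product of H_e. *)
Definition is_gradient B V C (N : field -> R) (e g : field) :=
  E0 B g /\
  forall h, E0 B h ->
    (fun t : R => (N (fun x => e x + t *: h x) - N e) / t) @ 0^' -->
      inner_He V C g h.

End fields.

(* Main.v *)
Require Import Defs.
From HB Require Import structures.
From mathcomp Require Import all_boot all_order all_algebra.
From mathcomp Require Import all_classical all_reals all_analysis.
From mathcomp Require Import measurable_realfun.
From mathcomp Require Import ring lra.
Import numFieldNormedType.Exports.
Import Order.TTheory GRing.Theory Num.Theory.
Set Implicit Arguments.
Unset Strict Implicit.
Unset Printing Implicit Defensive.
Local Open Scope classical_set_scope.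
Local Open Scope ring_scope.

(** The functional [N] is quadratic: if the Green operator [Gamma0] is linear,
    then [N (e + t h) - N e] equals [t (A, G) + O (t ^ 2)] with
    [A = Gamma0 (L (eps + e))] and [G = Gamma0 (L h)]. By its definition,
    [L0 (Gamma0 tau) - tau] is a periodic divergence-free stress. All such
    stresses are orthogonal to the strains in [E0], for the pairing
    [<s : e>] averaged over the cell, so that [L0 (Gamma0 tau)] and [tau] have the
    same pairing with every strain. Hence [(A, G) = <A : L h> = <L A : h>
    = (Gamma0 (L A), h)], where the middle equality is the symmetry of [L]. The
    same orthogonality and the positive definiteness of [L0] show that [Gamma0]
    is linear up to null sets, and that the gradient is unique.

    The analytic content is therefore the orthogonality
    [strain_stress_orthogonal]. The fields are merely square integrable, while
    the divergence and the gradient are tested on smooth functions with compact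
    support in the whole space. Let [s] be divergence free and periodic, let [w]
    be a periodic displacement with weak gradient [W], and let [rho] be a bump.
    Testing the divergence with [x |-> rho (x - y)], multiplying by [w y] and
    integrating [y] over a cell gives [0]. By Fubini's theorem and the translation
    invariance of cell integrals of periodic functions, the roles of [x] and [y]
    can be exchanged: now [x] ranges over the cell and the weak gradient is tested
    with [y |-> rho (x - y)]. The result, [divergence_free_correlation], is that
    the correlation [c z = \int s x : W (x + z) dx] over the cell has zero average
    against every reflected bump; the fields themselves are never mollified. Since
    [c] is continuous at [0] ([correlation_cvg]), bumps shrinking to the origin
    yield [c 0 = 0], which is the orthogonality.

    Three auxiliary facts support this. Lebesgue measure on row vectors is
    invariant under translations and reflections ([lebesgue_rV_affine]). Integrals
    of periodic functions do not depend on the cell ([ge0_integral_cell]), which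
    replaces a possibly unbounded cell by the parallelepiped spanned by the
    lattice basis. Correlations of locally square integrable functions are
    continuous: this is clear for indicators of sets with negligible boundary,
    extends to measurable sets by Dynkin's lemma and to all functions by
    approximation in mean square. The bumps are products over the coordinates of
    [exp (- 1 / (e + t)) exp (- 1 / (e - t))]. *)

(** * Isometries of Lebesgue measure *)

Section lebesgue_affine.
Variable R : realType.
Local Notation leb := (@lebesgue_measure R).

Definition is_sign (s : R) := s = 1 \/ s = -1.

Lemma is_sign1 : is_sign 1. Proof. by left. Qed.

Lemma is_signN1 : is_sign (-1). Proof. by right. Qed.

Lemma lebesgue_affine1 (s c : R) (A : set (measurableTypeR R)) :
  is_sign s -> measurable A ->
  leb ((fun t => s * t + c) @^-1` A) = leb A.
Proof.
move=> hs mA.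
have mf : measurable_fun setT (fun t : measurableTypeR R => s * t + c : measurableTypeR R).
  by apply: measurable_funD => //; exact: measurable_funM.
suff : leb A = pushforward leb (fun t : measurableTypeR R => s * t + c : measurableTypeR R) A by move=> ->.
apply: lebesgue_measure_unique => // _ [[a b] _ <-].
rewrite -[RHS]/(leb ((fun t : R => s * t + c) @^-1` `]a, b]%classic)) /=.
case: hs => ->.
- have -> : (fun t : R => 1 * t + c) @^-1` `]a, b]%classic = `]a - c, b - c]%classic.
    by apply/seteqP; split => t; rewrite /= !in_itv/=; lra.
  by rewrite !lebesgue_measure_itv/= !lte_fin ltrD2r -!EFinB; case: ifP => // _; congr (_%:E); lra.
- have -> : (fun t : R => -1 * t + c) @^-1` `]a, b]%classic = `[c - b, c - a[%classic.
    by apply/seteqP; split => t; rewrite /= !in_itv/=; lra.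
  rewrite !lebesgue_measure_itv/= !lte_fin ltrD2l ltrN2 -!EFinB; case: ifP => // _; congr (_%:E); lra.
Qed.

Lemma measurable_affine n (s : R) (c : 'rV[R]_n) :
  measurable_fun setT (fun x : 'rV[R]_n => s *: x + c).
Proof.
apply/measurable_fun_rVP => i.
under eq_fun do rewrite !mxE.
by apply: measurable_funD => //; apply: measurable_funM => //; exact: measurable_coord.
Qed.

(** By induction on the dimension: the sections of a preimage are preimages of
    sections, and the one-dimensional result moves the first coordinate. *)
Lemma lebesgue_rV_affine n (s : R) (c : 'rV[R]_n) (A : set 'rV[R]_n) :
  is_sign s -> measurable A ->
  lebesgue_rV R n ((fun x => s *: x + c) @^-1` A) = lebesgue_rV R n A.
Proof.
move=> hs; elim: n c A => [|n IH] c A mA.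
  have -> : (fun x : 'rV[R]_0 => s *: x + c) = id.
    by apply/funext => x; apply/rowP => -[].
  by [].
rewrite /= /cons_measure /pushforward /product_measure1/=.
set B := @cons_rV R n @^-1` A.
have mB : measurable B by rewrite -[B]setTI; exact: measurable_cons_rV.
pose c' : 'rV[R]_n := \row_i c 0 (lift ord0 i).
pose g t := lebesgue_rV R n (xsection B t).
have mg : measurable_fun setT g by exact: measurable_fun_xsection.
transitivity (\int[leb]_t g (s * t + c 0 ord0)%R)%E.
  apply: eq_integral => t _; rewrite /g.
  rewrite -(IH c' (xsection B _)); last exact: measurable_xsection.
  congr (lebesgue_rV R n _); apply/seteqP; rewrite /xsection.
  have E y : s *: cons_rV (t, y) + c = cons_rV (s * t + c 0 ord0, s *: y + c').
    have DE m (u v : 'rV[R]_m) i : (s *: u + v) 0 i = s * u 0 i + v 0 i.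
      by rewrite !mxE.
    apply/rowP => i; rewrite DE; case: (unliftP ord0 i) => [j|] ->.
      by rewrite !cons_rV_lift DE [c' 0 j]mxE.
    by rewrite !cons_rV0.
  by split => y /=; rewrite !inE /B /= E.
have mf : measurable_fun setT (fun t : measurableTypeR R => s * t + c 0 ord0 : measurableTypeR R).
  by apply: measurable_funD => //; exact: measurable_funM.
rewrite -[LHS](@ge0_integral_pushforward _ _ _ _ _ _ mf leb setT g)//.
by apply: eq_measure_integral => /= S mS _; exact: lebesgue_affine1.
Qed.

End lebesgue_affine.

Section affine_integral.
Variables (R : realType) (n : nat).
Local Notation mu := (lebesgue_rV R n).

Lemma ae_affine (s : R) (c : 'rV[R]_n) (P : 'rV[R]_n -> Prop) : is_sign s ->
  {ae mu, forall x, P x} -> {ae mu, forall x, P (s *: x + c)}.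
Proof.
move=> hs [N [mN N0 PN]]; exists ((fun x => s *: x + c) @^-1` N); split.
- by rewrite -[_ @^-1` _]setTI; exact: measurable_affine.
- by rewrite lebesgue_rV_affine.
- by move=> x /= /PN.
Qed.

Lemma ge0_integral_affine (s : R) (c : 'rV[R]_n) (f : 'rV[R]_n -> \bar R) :
  is_sign s -> measurable_fun setT f -> (forall x, 0 <= f x)%E ->
  (\int[mu]_x f (s *: x + c)%R = \int[mu]_x f x)%E.
Proof.
move=> hs mf f0.
rewrite -[LHS](@ge0_integral_pushforward _ _ _ _ _ _ (@measurable_affine _ _ s c) mu setT f)//.
by apply: eq_measure_integral => [|m S mS _]; [exact: measurable_affine|exact: lebesgue_rV_affine].
Qed.

Lemma Rintegral_affine (s : R) (c : 'rV[R]_n) (f : 'rV[R]_n -> R) :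
  is_sign s -> measurable_fun setT f ->
  \int[mu]_x f (s *: x + c) = \int[mu]_x f x.
Proof.
move=> hs mf; rewrite /Rintegral; congr fine.
have mE : measurable_fun setT (EFin \o f) by exact/measurable_EFinP.
have ma := @measurable_affine R n s c.
rewrite integralE [RHS]integralE; congr (_ - _)%E.
- rewrite -[RHS](ge0_integral_affine c hs)//; last exact: measurable_funepos.
  by apply: eq_integral => x _; rewrite !funeposE.
- rewrite -[RHS](ge0_integral_affine c hs)//; last exact: measurable_funeneg.
  by apply: eq_integral => x _; rewrite !funenegE.
Qed.

Lemma ae_shift (c : 'rV[R]_n) (P : 'rV[R]_n -> Prop) :
  {ae mu, forall x, P x} -> {ae mu, forall x, P (x + c)}.
Proof.
move=> /(ae_affine c (is_sign1 R)).
by apply: filterS => x; rewrite scale1r.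
Qed.

Lemma measurable_shift (c : 'rV[R]_n) :
  measurable_fun setT (fun x : 'rV[R]_n => x + c).
Proof.
have := @measurable_affine R n 1 c.
by under eq_fun do rewrite scale1r.
Qed.

Lemma ge0_integral_shift (c : 'rV[R]_n) (f : 'rV[R]_n -> \bar R) :
  measurable_fun setT f -> (forall x, 0 <= f x)%E ->
  (\int[mu]_x f (x + c)%R = \int[mu]_x f x)%E.
Proof.
move=> mf f0; rewrite -[RHS](ge0_integral_affine c (is_sign1 R))//.
by under [RHS]eq_integral do rewrite scale1r.
Qed.

Lemma Rintegral_shift (c : 'rV[R]_n) (f : 'rV[R]_n -> R) :
  measurable_fun setT f -> \int[mu]_x f (x + c) = \int[mu]_x f x.
Proof.
move=> mf; rewrite -[RHS](Rintegral_affine c (is_sign1 R))//.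
by under [RHS]eq_Rintegral do rewrite scale1r.
Qed.

Lemma Rintegral_opp (f : 'rV[R]_n -> R) :
  measurable_fun setT f -> \int[mu]_x f (- x) = \int[mu]_x f x.
Proof.
move=> mf; rewrite -[RHS](Rintegral_affine 0 (is_signN1 R))//.
by under [RHS]eq_Rintegral do rewrite scaleN1r addr0.
Qed.

End affine_integral.

(** * Unit cells *)

Section cubes.
Variables (R : realType) (n : nat).
Local Notation mu := (lebesgue_rV R n).

Definition cube (M : R) : set 'rV[R]_n := [set x | forall i, x 0 i \in `[- M, M]].

Lemma measurable_forall_coord (A : 'I_n -> set (measurableTypeR R)) :
  (forall i, measurable (A i)) ->
  measurable [set x : 'rV[R]_n | forall i, A i (x 0 i)].
Proof.
move=> mA.
have -> : [set x : 'rV[R]_n | forall i, A i (x 0 i)] =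
    \bigcap_k (if insub k is Some j then (fun x : 'rV[R]_n => x 0 j) @^-1` A j
               else setT).
  apply/seteqP; split => x /=; first by move=> h k _; case: insubP => // j _ _; exact: h.
  move=> h i; have := h i I; rewrite insubT// => ?.
  by rewrite (_ : Sub _ _ = i)//; exact/val_inj.
apply: bigcapT_measurable => k; case: insubP => // j _ _.
rewrite -[X in measurable X]setTI.
exact: (measurable_coord j measurableT (mA j)).
Qed.

Lemma measurable_cube M : measurable (cube M).
Proof. exact: (measurable_forall_coord (fun=> measurable_itv `[- M, M])). Qed.

Lemma compact_cube M : compact (cube M).
Proof. exact: (rV_compact (fun=> @segment_compact R (- M) M)). Qed.

Lemma subset_cube M M' : M <= M' -> cube M `<=` cube M'.
Proof.
by move=> MM' x + i => /(_ i); rewrite !in_itv/= => /andP[? ?]; apply/andP; lra.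
Qed.

Lemma cube_lty M : (mu (cube M) < +oo)%E.
Proof.
apply: (@le_lt_trans _ _ (mu (cube `|M|))).
  apply: le_measure; rewrite ?inE; [exact: measurable_cube..|].
  exact/subset_cube/ler_norm.
have := @lebesgue_rV_box R n (const_mx (- `|M|)) (const_mx `|M|).
have -> : [set x : 'rV[R]_n | forall i, x 0 i \in `[(const_mx (- `|M|) : 'rV[R]_n) 0 i,
    (const_mx `|M| : 'rV[R]_n) 0 i]] = cube `|M|.
  by apply/seteqP; split => x + i => /(_ i); rewrite !mxE.
by move=> ->; [rewrite ltry|move=> i; rewrite !mxE; have := normr_ge0 M; lra].
Qed.

Lemma cube_gt0 M : 0 < M -> (0 < mu (cube M))%E.
Proof.
move=> M0; have := @lebesgue_rV_box R n (const_mx (- M)) (const_mx M).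
have -> : [set x : 'rV[R]_n | forall i, x 0 i \in `[(const_mx (- M) : 'rV[R]_n) 0 i,
    (const_mx M : 'rV[R]_n) 0 i]] = cube M.
  by apply/seteqP; split => x + i => /(_ i); rewrite !mxE.
move=> ->; first by rewrite lte_fin; apply: prodr_gt0 => i _; rewrite !mxE; lra.
by move=> i; rewrite !mxE; lra.
Qed.

Lemma measurable_lin m (A : 'M[R]_(n, m)) :
  measurable_fun setT (fun x : 'rV[R]_n => x *m A).
Proof.
apply/measurable_fun_rVP => j.
under eq_fun do rewrite mxE.
apply: measurable_sum => k.
by apply: measurable_funM => //; exact: measurable_coord.
Qed.

End cubes.

Section unfolding.
Variables (R : realType) (d : nat) (B : 'M[R]_d).
Hypothesis hB : B \in unitmx.
Local Notation mu := (lebesgue_rV R d).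
Implicit Types V : set 'rV[R]_d.

Definition lat_vec (z : 'rV[int]_d) : 'rV[R]_d := map_mx intr z *m B.

Lemma lat_vecP z : lattice B (lat_vec z). Proof. by exists z. Qed.

Lemma lat_vecN z : lat_vec (- z) = - lat_vec z.
Proof. by rewrite /lat_vec map_mxN mulNmx. Qed.

Lemma lat_vec_inj : injective lat_vec.
Proof.
move=> z z' /(congr1 (mulmx^~ (invmx B))); rewrite /lat_vec !mulmxK//.
by move=> /matrixP h; apply/matrixP => i j; have := h i j; rewrite !mxE => /intr_inj.
Qed.

Lemma latticeN r : lattice B r -> lattice B (- r).
Proof. by move=> [z _ <-]; exists (- z) => //; rewrite -lat_vecN. Qed.

(** An arbitrary cell may be unbounded, where local integrability says nothing;
    the estimates are done on this bounded cell and carried over by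
    periodicity. *)
Definition parallelepiped : set 'rV[R]_d :=
  [set x | forall i, (x *m invmx B) 0 i \in `[0, 1[].

Lemma measurable_parallelepiped : measurable parallelepiped.
Proof.
have := measurable_lin (invmx B) measurableT
  (measurable_forall_coord (fun=> measurable_itv `[(0 : R), 1[)).
by rewrite setTI.
Qed.

Lemma parallelepiped_bounded : exists M, parallelepiped `<=` cube M.
Proof.
exists (\sum_i \sum_j `|B i j|) => x Px j.
rewrite in_itv/= -ler_norml -[x](mulmxKV hB) mxE.
apply: le_trans (ler_norm_sum _ _ _) _; apply: ler_sum => i _.
rewrite normrM (bigD1 j)//= -[leLHS]addr0 lerD ?sumr_ge0//.
have := Px i; rewrite in_itv/= => /andP[h0 h1].
by rewrite ler_piMl// ger0_norm// ltW.
Qed.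

Lemma parallelepiped_cell : unit_cell B parallelepiped.
Proof.
split; first exact: measurable_parallelepiped.
apply: aeW => x; pose y := x *m invmx B.
exists (lat_vec (map_mx Num.floor y)); split.
  split; first exact: lat_vecP.
  move=> i; rewrite mulmxBl /lat_vec mulmxK// !mxE in_itv/=.
  by have := floor_itv (y 0 i); rewrite intrD /y !mxE; lra.
move=> _ [[z _ <-] h]; congr (_ *m _); congr map_mx.
apply/rowP => i; have := h i.
rewrite mulmxBl mulmxK// !mxE in_itv/= => hi.
by apply: floor_def; rewrite intrD; lra.
Qed.

Lemma unit_cellP V x : (exists! r, lattice B r /\ V (x - r)) ->
  exists z, V (x - lat_vec z) /\ forall z', V (x - lat_vec z') -> z' = z.
Proof.
move=> [r [[[z _ <-] Vz] u]]; exists z; split => // z' Vz'.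
by apply: lat_vec_inj; rewrite -(u (lat_vec z'))//; split => //; exact: lat_vecP.
Qed.

(** A property invariant under the lattice that holds on a cell holds
    everywhere: the cell has countably many translates, which cover. *)
Lemma ae_cell V (P : 'rV[R]_d -> Prop) : unit_cell B V ->
  (forall r, lattice B r -> {ae mu, forall x, P (x + r) -> P x}) ->
  {ae mu, forall x, V x -> P x} -> {ae mu, forall x, P x}.
Proof.
move=> [mV cV] perP VP.
have h1 : {ae mu, forall x, forall n : nat,
    if pickle_inv n is Some z then V (x - lat_vec z) -> P x else True}.
  apply: ae_foralln => n; case: pickle_inv => [z|]; last exact: aeW.
  have := perP _ (latticeN (lat_vecP z)).
  have := ae_shift (- lat_vec z) VP.
  by apply: filterS2 => x h h' /h.
apply: filterS2 h1 cV => x h /unit_cellP[z [Vz _]].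
by have := h (pickle z); rewrite pickleK_inv; apply.
Qed.

(** Enumerating the lattice by [pickle_inv] makes each lattice vector occur
    exactly once; the other indices contribute [0]. *)
Definition tile V (s : R) (k : nat) (x : 'rV[R]_d) : R :=
  if pickle_inv k is Some z then \1_V (x + s *: lat_vec z) else 0.

Lemma tile_ge0 V s k x : 0 <= tile V s k x.
Proof. by rewrite /tile; case: pickle_inv. Qed.

Lemma measurable_tile V s k : measurable V -> measurable_fun setT (tile V s k).
Proof.
move=> mV; rewrite /tile; case: pickle_inv => [z|]; last exact: measurable_cst.
by apply: measurableT_comp (@measurable_shift R d _); exact: measurable_indic.
Qed.

(** The lattice is symmetric, so that the tiling property holds with either
    sign of the translations. *)
Lemma tile_sum V s : unit_cell B V -> is_sign s ->
  {ae mu, forall x, (\sum_(k <oo) (tile V s k x)%:E = 1)%E}.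
Proof.
move=> [_ cV] hs; apply: filterS cV => x /unit_cellP[z [Vz uz]].
have [z1 [Vz1 uz1]] : exists z1, V (x + s *: lat_vec z1) /\
    forall z', V (x + s *: lat_vec z') -> z' = z1.
  case: hs => ->; [exists (- z)|exists z].
    rewrite scale1r lat_vecN; split => // z' Vz'.
    by rewrite -(uz (- z')) ?opprK// lat_vecN opprK -[lat_vec z']scale1r.
  by rewrite scaleN1r; split => // z'; rewrite scaleN1r; exact: uz.
rewrite (@nneseriesD1 R _ (pickle z1))//; last by move=> k _; rewrite lee_fin tile_ge0.
rewrite {1}/tile pickleK_inv indicE mem_set//= eseries0 ?adde0// => k _ kz.
rewrite /tile; case E : pickle_inv => [z'|//].
rewrite indicE; case: (boolP (_ \in V)) => //; rewrite inE => /uz1 z'E.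
by move: kz; rewrite -z'E -(@pickle_invK 'rV[int]_d k) E /= eqxx.
Qed.

(** Unfolding: the translates of [V'] cut [V] into countably many pieces, which
    lattice vectors carry to the pieces into which the translates of [V]
    cut [V']. *)
Lemma ge0_integral_cell V V' (g : 'rV[R]_d -> R) :
  unit_cell B V -> unit_cell B V' -> measurable_fun setT g ->
  (forall x, 0 <= g x) -> Defs.periodic B g ->
  (\int[mu]_(x in V) (g x)%:E = \int[mu]_(x in V') (g x)%:E)%E.
Proof.
move=> cV cV' mg g0 pg; have mV := cV.1; have mV' := cV'.1.
pose F (A A' : set 'rV[R]_d) s k x : R := g x * \1_A x * tile A' s k x.
have F0 A A' s k x : 0 <= F A A' s k x.
  by rewrite /F !mulr_ge0// tile_ge0.
have mF (A A' : set 'rV[R]_d) s k : measurable A -> measurable A' ->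
    measurable_fun setT (F A A' s k).
  move=> mA mA'; apply: measurable_funM; last exact: measurable_tile.
  by apply: measurable_funM => //; exact: measurable_indic.
have split_tiles (A A' : set 'rV[R]_d) s : unit_cell B A' -> measurable A -> is_sign s ->
    (\int[mu]_(x in A) (g x)%:E = \sum_(k <oo) \int[mu]_x (F A A' s k x)%:E)%E.
  move=> cA' mA hs; have mA' := cA'.1.
  have mEF k : measurable_fun setT (fun x => (F A A' s k x)%:E).
    by apply/measurable_EFinP; exact: mF.
  rewrite integral_mkcond epatch_indic -integral_nneseries//; last first.
    by move=> k x _; rewrite lee_fin.
  apply: ge0_ae_eq_integral => //.
  - by apply: emeasurable_funM; apply/measurable_EFinP.
  - by apply: ge0_emeasurable_sum => [k x _ _|k _]; rewrite ?lee_fin.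
  - by move=> x _ /=; rewrite mule_ge0// lee_fin.
  - by move=> x _; apply: nneseries_ge0 => k _ _; rewrite lee_fin.
  apply: filterS (tile_sum cA' hs) => x tx _ /=.
  transitivity (\sum_(k <oo) ((g x * \1_A x)%:E * (tile A' s k x)%:E))%E.
    by rewrite nneseriesZl ?tx ?mule1 ?EFinM// => k _; rewrite lee_fin tile_ge0.
  by apply: eq_eseriesr => k _; rewrite -EFinM.
rewrite (split_tiles V V' (-1) cV' mV (is_signN1 R)).
rewrite (split_tiles V' V 1 cV mV' (is_sign1 R)).
apply: eq_eseriesr => k _.
case E : (pickle_inv k : option 'rV[int]_d) => [z|]; last first.
  by rewrite !integral0_eq// => x _; rewrite /F /tile E mulr0.
rewrite -(ge0_integral_shift (lat_vec z)); last 2 first.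
- by apply/measurable_EFinP; exact: mF.
- by move=> x; rewrite lee_fin.
apply: ge0_ae_eq_integral => //.
- apply/measurable_EFinP; apply: measurableT_comp (@measurable_shift R d _).
  exact: mF.
- by apply/measurable_EFinP; exact: mF.
- by move=> x _; rewrite lee_fin.
- by move=> x _; rewrite lee_fin.
apply: filterS (pg _ (lat_vecP z)) => x gx _.
by rewrite /F /tile E gx scaleN1r addrK scale1r mulrAC.
Qed.

End unfolding.

(** * Integrable and square-integrable functions *)

Section real_integrable.
Context dp (T : measurableType dp) (R : realType).
Variables (nu : {measure set T -> \bar R}) (D : set T) (mD : measurable D).
Implicit Types f g : T -> R.
Local Notation intg f := (nu.-integrable D (EFin \o f)).

Lemma intg_le f g : measurable_fun D f -> (forall x, D x -> `|f x| <= g x) ->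
  intg g -> intg f.
Proof.
move=> mf fg ig; apply: le_integrable ig => //; first exact/measurable_EFinP.
move=> x Dx; rewrite /= lee_fin (le_trans (fg _ Dx))//; exact: ler_norm.
Qed.

Lemma intgD f g : intg f -> intg g -> intg (fun x => f x + g x).
Proof. by move=> i1 i2; have := integrableD mD i1 i2. Qed.

Lemma intgZ c f : intg f -> intg (fun x => c * f x).
Proof. by move=> i1; have := integrableZl mD c i1. Qed.

Lemma intg_sum (I : Type) (s : seq I) (h : I -> T -> R) :
  (forall i, intg (h i)) -> intg (fun x => \sum_(i <- s) h i x).
Proof.
move=> ih; have := @integrable_sum _ _ _ nu D mD I s xpredT (fun i => EFin \o h i) (fun i _ => ih i).
by apply: eq_integrable => // x _ /=; rewrite sumEFin.
Qed.

Lemma Rintegral_sum (I : Type) (s : seq I) (h : I -> T -> R) :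
  (forall i, intg (h i)) ->
  \int[nu]_(x in D) (\sum_(i <- s) h i x) = \sum_(i <- s) \int[nu]_(x in D) h i x.
Proof.
move=> ih; elim: s => [|i s IH].
  under eq_Rintegral do rewrite big_nil.
  by rewrite big_nil Rintegral_cst// mul0r.
under eq_Rintegral do rewrite big_cons.
by rewrite big_cons RintegralD ?IH//; exact: intg_sum.
Qed.

Lemma ae_eq_Rintegral f g : measurable_fun D f -> measurable_fun D g ->
  {ae nu, forall x, D x -> f x = g x} ->
  \int[nu]_(x in D) f x = \int[nu]_(x in D) g x.
Proof.
move=> mf mg fg; congr fine; apply: ae_eq_integral => //.
- exact/measurable_EFinP.
- exact/measurable_EFinP.
- by apply: filterS fg => x /[apply] ->.
Qed.

End real_integrable.

Section real_fubini.
Context d1 d2 (T1 : measurableType d1) (T2 : measurableType d2) (R : realType).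
Variables (m1 : {sigma_finite_measure set T1 -> \bar R}).
Variables (m2 : {sigma_finite_measure set T2 -> \bar R}).

(** An integrable function is finite almost everywhere, so [fine] does not change
    its integral. *)
Lemma Rfubini_aux d (T : measurableType d) (m : {measure set T -> \bar R})
    (F : T -> \bar R) : m.-integrable setT F ->
  m.-integrable setT (EFin \o (fine \o F)) /\
  \int[m]_x fine (F x) = fine (\int[m]_x F x)%E.
Proof.
move=> iF; have mF := measurable_int m iF.
have aeF : {ae m, forall x, setT x -> F x = (EFin \o (fine \o F)) x}.
  by apply: filterS (integrable_ae measurableT iF) => x /[apply] /= Fx; rewrite fineK.
have mfF : measurable_fun setT (EFin \o (fine \o F)).
  by apply/measurable_EFinP; exact: measurableT_comp.
split; last by congr fine; apply: ae_eq_integral => //; apply: filterS aeF => x /[apply] ->.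
apply/integrableP; split => //.
have /integrableP[_] := iF; congr (_ < _)%E.
apply: ae_eq_integral => //; [exact: measurableT_comp..|].
by apply: filterS aeF => x /[apply] <-.
Qed.

Lemma Rfubini (G : T1 * T2 -> R) : (m1 \x m2)%E.-integrable setT (EFin \o G) ->
  [/\ m1.-integrable setT (EFin \o (fun x => \int[m2]_y G (x, y))),
      m2.-integrable setT (EFin \o (fun y => \int[m1]_x G (x, y))) &
      \int[m1]_x \int[m2]_y G (x, y) = \int[m2]_y \int[m1]_x G (x, y)].
Proof.
move=> iG.
have [i1 e1] := Rfubini_aux (integrable_fubini_F iG).
have mG := measurable_int _ iG.
have iG' : (m2 \x m1)%E.-integrable setT ((EFin \o G) \o (fun p : T2 * T1 => (p.2, p.1))).
  apply/integrable12ltyP; first exact: (measurableT_comp mG (measurable_fun_pair measurable_snd measurable_fst)).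
  exact: ((integrable21ltyP m1 m2 mG).1 iG).
have [i2 e2] := Rfubini_aux (integrable_fubini_F iG').
by split => //; rewrite [LHS]e1 [RHS]e2; congr fine; exact: Fubini.
Qed.

End real_fubini.

Section L2loc.
Variables (R : realType) (n : nat).
Local Notation mu := (lebesgue_rV R n).
Implicit Types f g k : 'rV[R]_n -> R.

(** Comparison of suprema over simple functions; it applies to arbitrary domains,
    such as the compact sets in [L2loc]. *)
Lemma ge0_integral_mono (D E : set 'rV[R]_n) (f g : 'rV[R]_n -> \bar R) :
  (forall x, 0 <= f x)%E -> (forall x, 0 <= g x)%E ->
  (forall x, D x -> E x /\ f x <= g x)%E ->
  (\int[mu]_(x in D) f x <= \int[mu]_(x in E) g x)%E.
Proof.
move=> f0 g0 fg; rewrite !ge0_integralE//.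
apply: le_ereal_sup => _ [h hf <-]; exists h => // x.
apply: le_trans (hf x) _; rewrite !patchE.
case: (boolP (x \in D)) => [|_]; last by case: ifP.
by rewrite inE => /fg[Ex fgx]; rewrite mem_set.
Qed.

Lemma compact_sub_cube (K : set 'rV[R]_n) : compact K -> exists M, K `<=` cube M.
Proof.
move=> cK.
have bK i : exists M, 0 <= M /\ forall x, K x -> `|x 0 i| <= M.
  have : compact ((fun x : 'rV[R]_n => x 0 i) @` K).
    apply: continuous_compact => //; apply: continuous_subspaceT => x.
    exact: coord_continuous.
  move=> /compact_bounded[M [_ hM]].
  exists (`|M| + 1); split; first by rewrite addr_ge0.
  move=> x Kx; apply: hM; last by exists x.
  by rewrite (le_lt_trans (ler_norm _))// ltrDl.
have [M hM] := choice bK.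
exists (\sum_i M i) => x Kx i.
rewrite in_itv/= -ler_norml (le_trans ((hM i).2 x Kx))//.
by rewrite (bigD1 i)//= lerDl sumr_ge0// => j _; case: (hM j).
Qed.

(** Every compact set lies in a cube, so cubes suffice to test local square
    integrability. *)
Lemma L2locP f : L2loc f <-> measurable_fun setT f /\
  forall M, (\int[mu]_(x in cube M) ((f x) ^+ 2)%:E < +oo)%E.
Proof.
split=> [[mf hf]|[mf hf]]; split => //.
  by move=> M; apply: hf; exact: compact_cube.
move=> K /compact_sub_cube[M KM]; apply: le_lt_trans (hf M).
by apply: ge0_integral_mono => [x|x|x /KM]; rewrite ?lee_fin ?sqr_ge0.
Qed.

Lemma L2loc_intg (D : set 'rV[R]_n) M f : measurable D -> D `<=` cube M -> L2loc f ->
  mu.-integrable D (EFin \o (fun x => f x ^+ 2)).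
Proof.
move=> mD DM /L2locP[mf hf].
apply: (@integrableS _ _ _ _ (cube M)) => //; first exact: measurable_cube.
apply/integrableP; split.
  by apply/measurable_EFinP; apply: measurable_funTS; exact: measurable_funX.
apply: le_lt_trans (hf M); rewrite le_eqVlt; apply/orP; left; apply/eqP.
by apply: eq_integral => x _ /=; rewrite ger0_norm// sqr_ge0.
Qed.

Lemma intg_L2loc f : measurable_fun setT f ->
  (forall M, mu.-integrable (cube M) (EFin \o (fun x => f x ^+ 2))) -> L2loc f.
Proof.
move=> mf hf; apply/L2locP; split => // M.
have /integrableP[_] := hf M; apply: le_lt_trans; rewrite le_eqVlt; apply/orP; left; apply/eqP.
by apply: eq_integral => x _ /=; rewrite ger0_norm// sqr_ge0.
Qed.

Lemma L2loc_mul_intg (D : set 'rV[R]_n) M f g : measurable D -> D `<=` cube M ->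
  L2loc f -> L2loc g -> mu.-integrable D (EFin \o (fun x => f x * g x)).
Proof.
move=> mD DM Lf Lg.
apply: (@intg_le _ _ _ _ _ mD _ (fun x => f x ^+ 2 + g x ^+ 2)) => //.
- by apply: measurable_funTS; apply: measurable_funM; [exact: Lf.1|exact: Lg.1].
- by move=> x _; rewrite ler_norml; apply/andP; split; nra.
- by apply: intgD => //; exact: L2loc_intg DM _.
Qed.

Lemma L2loc_cst c : L2loc (fun _ : 'rV[R]_n => c).
Proof.
apply: intg_L2loc; first exact: measurable_cst.
move=> M; have mM := @measurable_cube R n M; apply: measurable_bounded_integrable => //.
- exact: cube_lty.
- exists (c ^+ 2); split; first exact: num_real.
  by move=> y cy x _ /=; rewrite ger0_norm ?sqr_ge0// ltW.
Qed.

Lemma L2locD f g : L2loc f -> L2loc g -> L2loc (fun x => f x + g x).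
Proof.
move=> Lf Lg; apply: intg_L2loc; first by apply: measurable_funD; [exact: Lf.1|exact: Lg.1].
move=> M; have mM := @measurable_cube R n M.
apply: (@intg_le _ _ _ _ _ mM _ (fun x => 2 * (f x ^+ 2 + g x ^+ 2))) => //.
- apply: measurable_funTS; apply: measurable_funX.
  by apply: measurable_funD; [exact: Lf.1|exact: Lg.1].
- by move=> x _; rewrite ger0_norm ?sqr_ge0//; have := sqr_ge0 (f x - g x); nra.
- by apply: intgZ => //; apply: intgD => //; exact: (@L2loc_intg _ M).
Qed.

Lemma L2loc_bmul k f C : measurable_fun setT k -> {ae mu, forall x, `|k x| <= C} ->
  L2loc f -> L2loc (fun x => k x * f x).
Proof.
move=> mk kC Lf; have [mf hf] := (L2locP f).1 Lf.
apply/L2locP; split => [|M]; first exact: measurable_funM.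
have mM := @measurable_cube R n M.
apply: (@le_lt_trans _ _ (\int[mu]_(x in cube M) ((C * f x) ^+ 2)%:E)%E).
  apply: ae_ge0_le_integral => //.
  - by move=> x _; rewrite lee_fin sqr_ge0.
  - apply: measurable_funTS; apply/measurable_EFinP; apply: measurable_funX.
    exact: measurable_funM.
  - by move=> x _; rewrite lee_fin sqr_ge0.
  - apply: measurable_funTS; apply/measurable_EFinP; apply: measurable_funX.
    exact: measurable_funM.
  apply: filterS kC => x kC _; rewrite lee_fin !exprMn ler_wpM2r ?sqr_ge0//.
  by rewrite -[leLHS]real_normK ?num_real// lerXn2r ?nnegrE//; exact: le_trans kC.
have /integrableP[_] := intgZ mM (C ^+ 2) (L2loc_intg mM (@subset_refl _ _) Lf).
apply: le_lt_trans; rewrite le_eqVlt; apply/orP; left; apply/eqP.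
by apply: eq_integral => x _ /=; rewrite -exprMn ger0_norm// sqr_ge0.
Qed.

Lemma L2locZ c f : L2loc f -> L2loc (fun x => c * f x).
Proof.
by apply: (@L2loc_bmul (fun=> c) f `|c|); [exact: measurable_cst|exact: aeW].
Qed.

Lemma L2loc_sum (I : Type) (s : seq I) (h : I -> 'rV[R]_n -> R) :
  (forall i, L2loc (h i)) -> L2loc (fun x => \sum_(i <- s) h i x).
Proof.
move=> Lh; elim: s => [|i s IH].
  under eq_fun do rewrite big_nil; exact: L2loc_cst.
by under eq_fun do rewrite big_cons; exact: L2locD.
Qed.

Lemma L2loc_max0 f : L2loc f -> L2loc (fun x => Num.max (f x) 0).
Proof.
move=> Lf.
have mf : measurable_fun setT (fun x => Num.max (f x) 0).
  by apply: measurable_maxr; [exact: Lf.1|exact: measurable_cst].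
apply: intg_L2loc => // L; have mL := @measurable_cube R n L.
apply: (@intg_le _ _ _ _ _ mL _ (fun x => f x ^+ 2)).
- by apply: measurable_funTS; exact: measurable_funX.
- move=> x _; rewrite ger0_norm ?sqr_ge0//; case: (leP 0 (f x)) => //.
  by rewrite expr0n/= sqr_ge0.
- exact: (L2loc_intg mL (@subset_refl _ _)).
Qed.

End L2loc.

(** * Periodic functions *)

Section periodic_fields.
Variables (R : realType) (d : nat) (B : 'M[R]_d).
Hypothesis hB : B \in unitmx.
Local Notation mu := (lebesgue_rV R d).
Local Notation P := (parallelepiped B).
Implicit Types (V : set 'rV[R]_d) (a b : 'rV[R]_d -> R).

Lemma periodic_comp (T U : Type) (h : T -> U) (f : 'rV[R]_d -> T) :
  Defs.periodic B f -> Defs.periodic B (fun x => h (f x)).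
Proof. by move=> pf r /pf; apply: filterS => x ->. Qed.

Lemma periodic_comp2 (T1 T2 U : Type) (h : T1 -> T2 -> U)
    (f : 'rV[R]_d -> T1) (g : 'rV[R]_d -> T2) :
  Defs.periodic B f -> Defs.periodic B g -> Defs.periodic B (fun x => h (f x) (g x)).
Proof. by move=> pf pg r Br; apply: filterS2 (pf r Br) (pg r Br) => x -> ->. Qed.

Lemma periodic_shift (T : Type) (f : 'rV[R]_d -> T) c :
  Defs.periodic B f -> Defs.periodic B (fun x => f (x + c)).
Proof.
move=> pf r Br; apply: filterS (ae_shift c (pf r Br)) => x.
by rewrite addrAC.
Qed.

Lemma periodic_sum (I : Type) (s : seq I) (f : I -> 'rV[R]_d -> R) :
  (forall i, Defs.periodic B (f i)) -> Defs.periodic B (fun x => \sum_(i <- s) f i x).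
Proof.
move=> pf; elim: s => [|i s IH].
  by move=> r _; apply: aeW => x; rewrite !big_nil.
under eq_fun do rewrite big_cons.
exact: (periodic_comp2 +%R (pf i) IH).
Qed.

Lemma L2perD a b : L2per B a -> L2per B b -> L2per B (fun x => a x + b x).
Proof.
by move=> [La pa] [Lb pb]; split; [exact: L2locD|exact: (periodic_comp2 +%R)].
Qed.

Lemma L2perZ c a : L2per B a -> L2per B (fun x => c * a x).
Proof. by move=> [La pa]; split; [exact: L2locZ|exact: (periodic_comp ( *%R c))]. Qed.

Lemma Rintegral_cell V V' a : unit_cell B V -> unit_cell B V' ->
  measurable_fun setT a -> Defs.periodic B a ->
  \int[mu]_(x in V) a x = \int[mu]_(x in V') a x.
Proof.
move=> cV cV' ma pa; congr fine; rewrite integralE [RHS]integralE; congr (_ - _)%E.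
- have -> : ((fun x => (a x)%:E)^\+)%E = (fun x => (Num.max (a x) 0)%:E).
    by apply/funext => x; rewrite funeposE EFin_max.
  apply: (ge0_integral_cell hB cV cV').
  + by apply: measurable_maxr => //; exact: measurable_cst.
  + by move=> x; rewrite le_max lexx orbT.
  + exact: (periodic_comp (fun t => Num.max t 0)).
- have -> : ((fun x => (a x)%:E)^\-)%E = (fun x => (Num.max (- a x) 0)%:E).
    by apply/funext => x; rewrite funenegE EFin_max.
  apply: (ge0_integral_cell hB cV cV').
  + by apply: measurable_maxr; [exact: measurable_funN|exact: measurable_cst].
  + by move=> x; rewrite le_max lexx orbT.
  + exact: (periodic_comp (fun t => Num.max (- t) 0)).
Qed.

Lemma intg_cell V V' a : unit_cell B V -> unit_cell B V' ->
  measurable_fun setT a -> Defs.periodic B a ->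
  mu.-integrable V (EFin \o a) -> mu.-integrable V' (EFin \o a).
Proof.
move=> cV cV' ma pa /integrableP[_ ia]; apply/integrableP; split.
  by apply: measurable_funTS; exact/measurable_EFinP.
apply: le_lt_trans ia; rewrite le_eqVlt; apply/orP; left; apply/eqP.
apply: (ge0_integral_cell hB cV' cV) => //; first exact: measurableT_comp.
exact: (periodic_comp Num.norm).
Qed.

Lemma L2per_mul_intg V a b : unit_cell B V -> L2per B a -> L2per B b ->
  mu.-integrable V (EFin \o (fun x => a x * b x)).
Proof.
move=> cV [La pa] [Lb pb]; apply: (intg_cell (parallelepiped_cell hB) cV).
- by apply: measurable_funM; [exact: La.1|exact: Lb.1].
- exact: (periodic_comp2 *%R).
- have [M PM] := parallelepiped_bounded hB.
  by apply: L2loc_mul_intg PM _ _ => //; exact: measurable_parallelepiped.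
Qed.

Lemma cell_lty V : unit_cell B V -> (mu V < +oo)%E.
Proof.
move=> cV; have cP := parallelepiped_cell hB.
have := ge0_integral_cell hB cV cP (@measurable_cst _ _ _ _ setT (1 : R))
  (fun=> ler01) _.
have int1 W : measurable W -> (\int[mu]_(x in W) (1 : R)%:E = mu W)%E.
  by move=> mW; rewrite -[RHS]mul1e; exact: (integral_cst mu mW 1%E).
rewrite !int1; [|exact: cP.1|exact: cV.1].
move=> ->; last by move=> r _; exact: aeW.
have [M PM] := parallelepiped_bounded hB.
apply: le_lt_trans (cube_lty d M).
by apply: le_measure => //; rewrite inE; [exact: cP.1|exact: measurable_cube].
Qed.

(** The translates of a null cell would be null, and they cover the space. *)
Lemma cell_gt0 V : unit_cell B V -> (0 < mu V)%E.
Proof.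
move=> cV; rewrite lt0e measure_ge0 andbT; apply/eqP => V0.
have h : {ae mu, forall x : 'rV[R]_d, False}.
  apply: (ae_cell hB cV) => [r _|]; first exact: aeW.
  by exists V; split => //; [exact: cV.1|move=> x /= /not_implyP[]].
have := cube_gt0 d (@ltr01 R).
case: h => N [mN N0 sN]; suff -> : mu (cube 1) = 0%E by rewrite ltxx.
apply: (subset_measure0 (@measurable_cube R d 1) mN _ N0).
by move=> x _; apply: sN.
Qed.

Lemma shifted_cell V z : unit_cell B V -> unit_cell B [set x | V (x + z)].
Proof.
move=> [mV cV]; split.
  by rewrite -[X in measurable X]setTI; exact: (measurable_shift z measurableT).
apply: filterS (ae_shift z cV) => x [r [[Br Vr] u]]; exists r; split.
  by split => //=; rewrite addrAC.
by move=> r' [Br' /= Vr']; apply: u; split => //; rewrite addrAC.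
Qed.

(** A translate of a cell is again a cell. *)
Lemma Rintegral_cell_shift V a z : unit_cell B V ->
  measurable_fun setT a -> Defs.periodic B a ->
  \int[mu]_(x in V) a (x + z) = \int[mu]_(x in V) a x.
Proof.
move=> cV ma pa; have mV := cV.1.
rewrite [RHS](Rintegral_cell cV (shifted_cell (- z) cV) ma pa).
rewrite [RHS]Rintegral_mkcond -[RHS](Rintegral_shift z); last first.
  apply/(measurable_restrictT _ _).1 => //; last exact: measurable_funTS.
  exact: (shifted_cell (- z) cV).1.
rewrite [LHS]Rintegral_mkcond; apply: eq_Rintegral => x _.
rewrite !patchE; congr (if _ then _ else _); apply/idP/idP; rewrite !inE /=.
  by rewrite addrK.
by rewrite addrK.
Qed.

End periodic_fields.

(** * Correlation integrals *)

Section correlation.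
Variables (R : realType) (n : nat).
Local Notation mu := (lebesgue_rV R n).
Implicit Types (a b k : 'rV[R]_n -> R) (D : set 'rV[R]_n).

Definition bounded_kernel k := measurable_fun setT k /\
  exists C N : R, (forall x, `|k x| <= C) /\ (forall x, ~ cube N x -> k x = 0).

Lemma measurable_addpair :
  measurable_fun setT (fun p : 'rV[R]_n * 'rV[R]_n => p.1 + p.2).
Proof.
apply/measurable_fun_rVP => i; under eq_fun do rewrite mxE.
by apply: measurable_funD; apply: measurableT_comp (measurable_coord i) _.
Qed.

Lemma integral_sqr_shift b (c : 'rV[R]_n) M N : measurable_fun setT b ->
  (forall i, `|c 0 i| <= N) ->
  (\int[mu]_(x in cube M) ((b (x + c)) ^+ 2)%:E <=
   \int[mu]_(x in cube (M + N)) ((b x) ^+ 2)%:E)%E.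
Proof.
move=> mb cN; rewrite integral_mkcond [leRHS]integral_mkcond.
have h0 (f : 'rV[R]_n -> R) A x : (0 <= ((fun x => (f x ^+ 2)%:E) \_ A) x)%E.
  by rewrite patchE; case: ifP => // _; rewrite lee_fin sqr_ge0.
rewrite -[leRHS](ge0_integral_shift c)//; last first.
  apply/(measurable_restrictT _ _).1; first exact: measurable_cube.
  by apply: measurable_funTS; apply/measurable_EFinP; exact: measurable_funX.
apply: ge0_integral_mono => // x _; split => //.
rewrite !patchE; case: ifPn => [|_]; last by case: ifP => // _; rewrite lee_fin sqr_ge0.
rewrite inE => Mx; rewrite mem_set// => i.
by have := Mx i; have := cN i; rewrite !in_itv/= mxE ler_norml; lra.
Qed.

(** The inequality [|a b| <= a ^ 2 + b ^ 2] bounds the integral in [x] uniformly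
    in the shift, as long as the shift stays in the support of [k]. *)
Lemma correlation_integrable D M a b k : measurable D -> D `<=` cube M ->
  L2loc a -> L2loc b -> bounded_kernel k ->
  (mu \x mu)%E.-integrable setT
    (EFin \o (fun p : 'rV[R]_n * 'rV[R]_n => (a \_ D) p.1 * (b (p.1 + p.2) * k p.2))).
Proof.
move=> mD DM La Lb [mk [C [N [kC kN]]]].
have maD : measurable_fun setT (a \_ D).
  by apply/(measurable_restrictT _ _).1 => //; apply: measurable_funTS; exact: La.1.
have mG : measurable_fun setT (fun p : 'rV[R]_n * 'rV[R]_n =>
    (a \_ D) p.1 * (b (p.1 + p.2) * k p.2)).
  apply: measurable_funM; first exact: measurableT_comp maD measurable_fst.
  apply: measurable_funM; last exact: measurableT_comp mk measurable_snd.
  exact: measurableT_comp Lb.1 measurable_addpair.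
apply/integrable21ltyP; first exact/measurable_EFinP.
have mM := @measurable_cube R n M; have mN := @measurable_cube R n N.
have mMN := @measurable_cube R n (M + N).
have C0 : 0 <= C by exact: le_trans (kC 0).
have fin2 f L : L2loc f -> exists2 q : R, 0 <= q &
    (\int[mu]_(x in cube L) (f x ^+ 2)%:E <= q%:E)%E.
  move=> /L2locP[_ /(_ L) hf].
  exists (fine (\int[mu]_(x in cube L) (f x ^+ 2)%:E)).
    by apply: fine_ge0; apply: integral_ge0 => x _; rewrite lee_fin sqr_ge0.
  rewrite fineK// ge0_fin_numE//.
  by apply: integral_ge0 => x _; rewrite lee_fin sqr_ge0.
have [qa qa0 ha] := fin2 a M La; have [qb qb0 hb] := fin2 b (M + N) Lb.
apply: (@le_lt_trans _ _ (\int[mu]_(z in cube N) (C * (qa + qb))%:E)%E); last first.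
  rewrite integral_cst// lte_mul_pinfty ?lee_fin//; last exact: cube_lty.
  by rewrite mulr_ge0// addr_ge0.
rewrite [leRHS]integral_mkcond.
apply: ge0_integral_mono => [z|z|z _]; first exact: integral_ge0.
  by rewrite patchE; case: ifP => //; rewrite lee_fin mulr_ge0// addr_ge0.
split => //; rewrite patchE; case: ifPn => Nz; last first.
  rewrite integral0_eq// => x _ /=; rewrite (kN z) ?mulr0 ?normr0//.
  by move=> h; move: Nz; rewrite mem_set.
rewrite inE in Nz.
apply: (@le_trans _ _ (\int[mu]_(x in cube M)
    (C * (a x ^+ 2 + b (x + z) ^+ 2))%:E)%E).
  have le_ab x : (0 <= C * (a x ^+ 2 + b (x + z) ^+ 2)).
    by rewrite mulr_ge0// addr_ge0 ?sqr_ge0.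
  rewrite [leRHS]integral_mkcond; apply: ge0_integral_mono => // [x|x _].
    by rewrite patchE; case: ifP => // _; rewrite lee_fin.
  split => //; rewrite [leRHS]patchE /= patchE.
  case: ifPn => [|_]; last by rewrite mul0r normr0; case: ifP => // _; rewrite lee_fin.
  rewrite inE => /DM Mx; rewrite mem_set// lee_fin mulrA normrM mulrC.
  apply: ler_pM => //; rewrite ler_norml; apply/andP; split; nra.
have mb : measurable_fun setT (fun x : 'rV[R]_n => (b (x + z) ^+ 2)%:E).
  apply/measurable_EFinP; apply: measurable_funX.
  exact: measurableT_comp Lb.1 (measurable_shift z).
have ma : measurable_fun setT (fun x => (a x ^+ 2)%:E).
  by apply/measurable_EFinP; apply: measurable_funX; exact: La.1.
under eq_integral do rewrite EFinM EFinD.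
rewrite ge0_integralZl//=; last 2 first.
- by apply: measurable_funTS; exact: emeasurable_funD.
- by move=> x _; rewrite lee_fin addr_ge0 ?sqr_ge0.
rewrite EFinM lee_wpmul2l ?lee_fin//.
have sq0 (f : 'rV[R]_n -> R) x : (0 <= (f x ^+ 2)%:E)%E by rewrite lee_fin sqr_ge0.
rewrite ge0_integralD//=; [|exact: measurable_funTS..].
rewrite EFinD leeD//; apply: le_trans hb.
apply: integral_sqr_shift => [|i]; first exact: Lb.1.
by have := Nz i; rewrite in_itv/= ler_norml.
Qed.

Lemma L2loc_shift b c : L2loc b -> L2loc (fun x => b (x + c)).
Proof.
move=> Lb; apply/L2locP; split.
  exact: measurableT_comp Lb.1 (measurable_shift c).
move=> M; pose N := \sum_i `|c 0 i|.
have /L2locP[_ /(_ (M + N))] := Lb; apply: le_lt_trans.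
apply: integral_sqr_shift => [|i]; first exact: Lb.1.
by rewrite /N (bigD1 i)//= lerDl sumr_ge0.
Qed.

Lemma kernel_L2loc k : bounded_kernel k -> L2loc k.
Proof.
move=> [mk [C [_ [kC _]]]].
have := @L2loc_bmul R n k (fun=> 1) C mk (aeW _ kC) (@L2loc_cst R n 1).
by under eq_fun do rewrite mulr1.
Qed.

Lemma kernel_intg k b : bounded_kernel k -> L2loc b ->
  mu.-integrable setT (EFin \o (fun x => b x * k x)).
Proof.
move=> bk Lb; have [_ [_ [N [_ kN]]]] := bk; have mN := @measurable_cube R n N.
have : mu.-integrable (cube N) (EFin \o (fun x => b x * k x)).
  exact: (L2loc_mul_intg mN (@subset_refl _ _) Lb (kernel_L2loc bk)).
move/(integrable_mkcond _ mN).1; apply: eq_integrable => // x _.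
rewrite patchE; case: ifPn => //= Nx; rewrite (kN x) ?mulr0// => h.
by move: Nx; rewrite mem_set.
Qed.

(** The substitution [y = x + z] followed by the exchange of the two integrals. *)
Lemma correlation_swap D M a b k : measurable D -> D `<=` cube M ->
  L2loc a -> L2loc b -> bounded_kernel k ->
  [/\ mu.-integrable D (EFin \o (fun x => a x * \int[mu]_y (b y * k (y - x)))),
      mu.-integrable setT (EFin \o (fun z => k z * \int[mu]_(x in D) (a x * b (x + z)))) &
      \int[mu]_(x in D) (a x * \int[mu]_y (b y * k (y - x))) =
      \int[mu]_z (k z * \int[mu]_(x in D) (a x * b (x + z)))].
Proof.
move=> mD DM La Lb bk.
have [i1 i2 e12] := Rfubini (correlation_integrable mD DM La Lb bk).
have F1 x : \int[mu]_z ((a \_ D) x * (b (x + z) * k z)) =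
    ((fun x => a x * \int[mu]_y (b y * k (y - x))) \_ D) x.
  rewrite RintegralZl//; last first.
    have := kernel_intg bk (L2loc_shift x Lb).
    by under eq_fun do rewrite [in b _]addrC.
  rewrite [RHS]patchE patchE; case: ifP => _; last by rewrite mul0r.
  rewrite -[in RHS](Rintegral_shift x).
    by congr (_ * _); apply: eq_Rintegral => y _; rewrite addrK [y + x]addrC.
  apply: measurable_funM; first exact: Lb.1.
  exact: measurableT_comp bk.1 (measurable_shift (- x)).
have F2 z : \int[mu]_x ((a \_ D) x * (b (x + z) * k z)) =
    k z * \int[mu]_(x in D) (a x * b (x + z)).
  transitivity (\int[mu]_(x in D) (k z * (a x * b (x + z)))).
    rewrite [RHS]Rintegral_mkcond; apply: eq_Rintegral => x _; rewrite !patchE.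
    by case: ifP => _; rewrite ?mul0r//; ring.
  by rewrite RintegralZl//; exact: (L2loc_mul_intg mD DM La (L2loc_shift z Lb)).
split.
- apply/(integrable_mkcond _ mD).2; apply: eq_integrable i1 => // x _ /=.
  by rewrite F1 !patchE; case: ifP.
- by apply: eq_integrable i2 => // z _ /=; rewrite F2.
- rewrite [LHS]Rintegral_mkcond.
  transitivity (\int[mu]_x \int[mu]_z ((a \_ D) x * (b (x + z) * k z))).
    by apply: eq_Rintegral => x _; rewrite F1.
  by rewrite [LHS]e12; apply: eq_Rintegral => z _; exact: F2.
Qed.

End correlation.

(** * Continuity of correlations *)

Section correlation_continuity.
Variables (R : realType) (n : nat) (z_ : nat -> 'rV[R]_n).
Hypothesis hz : forall k i, `|z_ k 0 i| <= k.+1%:R^-1.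
Local Notation mu := (lebesgue_rV R n).
Implicit Types (a b : 'rV[R]_n -> R) (A : set 'rV[R]_n).

Lemma near_shift_coord (i : 'I_n) e : 0 < e -> \forall k \near \oo, `|z_ k 0 i| < e.
Proof.
move=> e0; near=> k; apply: le_lt_trans (hz k i) _.
rewrite -[e]invrK ltf_pV2 ?posrE ?invr_gt0// -natr1.
apply: lt_trans (_ : k%:R < _); last by rewrite ltrDl.
by near: k; exact: nbhs_infty_gtr.
Unshelve. all: by end_near. Qed.

(** A bounded piece of a hyperplane is a box with one side of length [0]. *)
Lemma hyperplane_null (i : 'I_n) c : {ae mu, forall x : 'rV[R]_n, x 0 i != c}.
Proof.
pose A N : set 'rV[R]_n := [set x | forall j,
  x 0 j \in `[(\row_j (if j == i then c else - N%:R)) 0 j, (\row_j (if j == i then c else N%:R)) 0 j]].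
have A0 N : mu (A N) = 0.
  rewrite lebesgue_rV_box; first by rewrite (bigD1 i)//= !mxE eqxx subrr mul0r.
  by move=> j; rewrite !mxE; case: ifP => // _; have := ler0n R N; lra.
have mA N : measurable (A N).
  exact: (measurable_forall_coord (fun j => measurable_itv `[_, _])).
suff : mu.-negligible [set x | x 0 i = c].
  by apply: negligibleS => x /= /negP; rewrite negbK => /eqP.
apply: (negligibleS (A := \bigcup_N A N)); last first.
  by apply: negligible_bigcup => N; exists (A N); split; [exact: mA|exact: A0|].
move=> x /= xc; pose N := (Num.truncn (\sum_j `|x 0 j|)).+1.
have Nx j : `|x 0 j| <= N%:R.
  apply: le_trans (ltW (truncnS_gt _)).
  by rewrite (bigD1 j)//= lerDl sumr_ge0.
exists N => // j; rewrite !mxE in_itv/=; case: eqP => [->|_]; first by rewrite xc lexx.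
by have := Nx j; rewrite ler_norml.
Qed.

(** Sets with negligible boundary, as far as the translations [z_ k] can tell. *)
Definition stable A :=
  {ae mu, forall x, \forall k \near \oo, A (x - z_ k) <-> A x}.

Lemma stable_setI A A' : stable A -> stable A' -> stable (A `&` A').
Proof.
rewrite /stable => sA sA'; apply: filterS2 sA sA' => x sA sA'.
by apply: filterS2 sA sA' => k hA hA'; split => -[/hA ? /hA' ?].
Qed.

Lemma stable_lt i c : stable [set x : 'rV[R]_n | x 0 i < c].
Proof.
rewrite /stable; apply: filterS (hyperplane_null i c) => x xc.
have e0 : 0 < `|c - x 0 i| by rewrite normr_gt0 subr_eq0 eq_sym.
apply: filterS (near_shift_coord i e0) => k /=; rewrite !mxE ltr_norml.
move: xc; rewrite neq_lt => /orP[] h.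
  by rewrite (@gtr0_norm _ (c - _)) => [/andP[h1 h2]|]; [split|]; lra.
by rewrite (@ltr0_norm _ (c - _)) => [/andP[h1 h2]|]; [split|]; lra.
Qed.

Lemma stable_cube M : stable (cube M).
Proof.
rewrite /stable.
have : {ae mu, forall x : 'rV[R]_n, forall i : 'I_n,
    \forall k \near \oo, (x - z_ k) 0 i \in `[- M, M] = (x 0 i \in `[- M, M])}.
  have ae1 (i : 'I_n) : {ae mu, forall x : 'rV[R]_n,
      \forall k \near \oo, (x - z_ k) 0 i \in `[- M, M] = (x 0 i \in `[- M, M])}.
    apply: filterS2 (hyperplane_null i M) (hyperplane_null i (- M)) => x x1 x2.
    have e1 : 0 < `|M - x 0 i| by rewrite normr_gt0 subr_eq0 eq_sym.
    have e2 : 0 < `|- M - x 0 i| by rewrite normr_gt0 subr_eq0 eq_sym.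
    apply: filterS2 (near_shift_coord i e1) (near_shift_coord i e2) => k.
    rewrite !mxE !in_itv/= => h1 h2.
    have near_itv c : x 0 i != c -> `|z_ k 0 i| < `|c - x 0 i| ->
        (x 0 i - z_ k 0 i < c) = (x 0 i < c) /\ (c < x 0 i - z_ k 0 i) = (c < x 0 i).
      rewrite neq_lt ltr_norml => /orP[] h.
        rewrite (@gtr0_norm _ (c - _)) => [/andP[h3 h4]|]; last by lra.
        by split; apply/idP/idP; lra.
      rewrite (@ltr0_norm _ (c - _)) => [/andP[h3 h4]|]; last by lra.
      by split; apply/idP/idP; lra.
    have [_ e3] := near_itv _ x1 h1; have [e4 _] := near_itv _ x2 h2.
    by rewrite !leNgt e3 e4.
  exact: filter_forall.
apply: filterS => x /filter_forall; apply: filterS => k h.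
by split => + i => /(_ i); rewrite h.
Qed.

(** Half-spaces [x_i < c] are stable and their traces generate the Borel sets of
    each coordinate. *)
Lemma stable_generates : @measurable _ 'rV[R]_n = <<s [set A | measurable A /\ stable A] >>.
Proof.
apply/seteqP; split; last first.
  by apply: smallest_sub; [exact: sigma_algebra_measurable|move=> A []].
set G := [set A | _].
have mid : measurable_fun setT (@id 'rV[R]_n : g_sigma_algebraType G -> 'rV[R]_n).
  apply/measurable_fun_rVP => i.
  apply: (measurability _ (RGenInftyO.measurableE R)) => //.
  move=> _ [_ [c ->] <-]; rewrite setTI; apply: sub_gen_smallest; split.
    rewrite -[X in measurable X]setTI.
    exact: (measurable_coord i measurableT (measurable_itv `]-oo, c[)).
  have -> : (fun x : 'rV[R]_n => x 0 i) @^-1` `]-oo, c[%classic = [set x : 'rV[R]_n | x 0 i < c].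
    by apply/seteqP; split => x /=; rewrite in_itv.
  exact: stable_lt.
by move=> A mA; have := mid measurableT A mA; rewrite setTI preimage_id.
Qed.

Section fixed_field.
Variables (b : 'rV[R]_n -> R) (M : R).
Hypothesis Lb : L2loc b.
Local Notation Q := (@cube R n M).

Let corr a z := \int[mu]_(x in Q) (a x * b (x + z)).
Let good a := L2loc a /\ corr a (z_ k) @[k --> \oo] --> corr a 0.

Let mQ : measurable Q := @measurable_cube R n M.

Let ib a z : L2loc a -> mu.-integrable Q (EFin \o (fun x => a x * b (x + z))).
Proof. by move=> La; apply: (L2loc_mul_intg mQ (@subset_refl _ _)) => //; exact: L2loc_shift. Qed.

Let goodD a a' : good a -> good a' -> good (fun x => a x + a' x).
Proof.
move=> [La ca] [La' ca']; split; first exact: L2locD.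
have corrD z : corr (fun x => a x + a' x) z = corr a z + corr a' z.
  rewrite /corr -RintegralD//; [|exact: ib..].
  by apply: eq_Rintegral => x _; rewrite mulrDl.
by under eq_cvg do rewrite corrD; rewrite corrD; exact: cvgD.
Qed.

Let goodZ c a : good a -> good (fun x => c * a x).
Proof.
move=> [La ca]; split; first exact: L2locZ.
have corrZ z : corr (fun x => c * a x) z = c * corr a z.
  rewrite /corr -RintegralZl//; last exact: ib.
  by apply: eq_Rintegral => x _; rewrite mulrA.
by under eq_cvg do rewrite corrZ; rewrite corrZ; exact: cvgMr.
Qed.

Let good0 : good (fun=> 0).
Proof.
split; first exact: L2loc_cst.
have corr0 z : corr (fun=> 0) z = 0.
  by rewrite /corr; under eq_Rintegral do rewrite mul0r; rewrite Rintegral_cst// mul0r.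
by under eq_cvg do rewrite corr0; rewrite corr0; exact: cvg_cst.
Qed.

Let good_sum (I : Type) (s : seq I) (h : I -> 'rV[R]_n -> R) :
  (forall i, good (h i)) -> good (fun x => \sum_(i <- s) h i x).
Proof.
move=> gh; elim: s => [|i s IH].
  by under eq_fun do rewrite big_nil.
by under eq_fun do rewrite big_cons; exact: goodD.
Qed.

Let sq_int L : mu.-integrable (cube L) (EFin \o (fun x => b x ^+ 2)).
Proof. exact: (L2loc_intg (@measurable_cube R n L) (@subset_refl _ _)). Qed.

Let K := \int[mu]_(x in cube (M + 1)) b x ^+ 2.

(** Young's inequality with a free weight [s]: the bound is uniform in the
    shift, and small once [u] is small in mean square and [s] is large. *)
Let corr_bound u (z : 'rV[R]_n) (s : R) : L2loc u -> (forall i, `|z 0 i| <= 1) -> 0 < s ->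
  `|corr u z| <= s * \int[mu]_(x in Q) u x ^+ 2 + s^-1 * K.
Proof.
move=> Lu hz1 s0; have Lz := L2loc_shift z Lb.
have iu : mu.-integrable Q (EFin \o (fun x => u x ^+ 2)).
  exact: (L2loc_intg mQ (@subset_refl _ _)).
have iz : mu.-integrable Q (EFin \o (fun x => b (x + z) ^+ 2)).
  exact: (L2loc_intg mQ (@subset_refl _ _) Lz).
apply: le_trans (le_normr_Rintegral mQ (ib z Lu)) _.
apply: (@le_trans _ _ (\int[mu]_(x in Q) (s * u x ^+ 2 + s^-1 * b (x + z) ^+ 2))).
  apply: le_Rintegral => //.
  - exact: (integrable_norm (ib z Lu)).
  - by apply: intgD => //; exact: intgZ.
  - move=> x _; rewrite normrM.
    have : 0 <= s^-1 * (s * `|u x| - `|b (x + z)|) ^+ 2.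
      by rewrite mulr_ge0 ?sqr_ge0// invr_ge0 ltW.
    have -> : s^-1 * (s * `|u x| - `|b (x + z)|) ^+ 2 =
        s * `|u x| ^+ 2 + s^-1 * `|b (x + z)| ^+ 2 - 2 * (`|u x| * `|b (x + z)|).
      by field; rewrite gt_eqF.
    rewrite !real_normK ?num_real// => h.
    by have := mulr_ge0 (normr_ge0 (u x)) (normr_ge0 (b (x + z))); lra.
rewrite RintegralD ?RintegralZl//; [|exact: intgZ..].
rewrite lerD2l; apply: ler_wpM2l; first by rewrite invr_ge0 ltW.
rewrite /K /Rintegral fine_le//.
- exact: integrable_fin_num iz.
- exact: (integrable_fin_num (measurable_cube (M + 1)) (sq_int _)).
- by apply: integral_sqr_shift => //; exact: Lb.1.
Qed.

Let hz1 k i : `|z_ k 0 i| <= 1.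
Proof. by apply: le_trans (hz k i) _; rewrite invf_le1// ler1n. Qed.

Let good_approx a : L2loc a ->
  (forall e, 0 < e -> exists2 a', good a' &
    \int[mu]_(x in Q) (a x - a' x) ^+ 2 <= e) -> good a.
Proof.
move=> La ha; split => //; apply/cvgrPdist_le => e e0.
have K0 : 0 <= K by apply: Rintegral_ge0 => x _; exact: sqr_ge0.
(* This weight makes the second term of [corr_bound] at most [e / 6]. *)
pose s := 6 * (K + 1) / e.
have s0 : 0 < s by rewrite /s divr_gt0// mulr_gt0// ltr_wpDl.
have [|a' [La' ca'] aa'] := ha (s^-1 * (e / 6)).
  by rewrite mulr_gt0 ?invr_gt0// divr_gt0.
have Lu : L2loc (fun x => a x - a' x).
  by have := L2locD La (L2locZ (-1) La'); under eq_fun do rewrite mulN1r.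
have bnd (z : 'rV[R]_n) : (forall i, `|z 0 i| <= 1) -> `|corr a z - corr a' z| <= e / 3.
  move=> z1; rewrite /corr -RintegralB//; [|exact: ib..].
  under eq_Rintegral do rewrite -mulrBl.
  apply: le_trans (corr_bound Lu z1 s0) _.
  have h1 : s * \int[mu]_(x in Q) (a x - a' x) ^+ 2 <= e / 6.
    by rewrite -ler_pdivlMl.
  have h2 : s^-1 * K <= e / 6.
    rewrite /s ler_pdivrMl//.
    rewrite [leRHS](_ : _ = K + 1); first by rewrite lerDl.
    by field; rewrite gt_eqF.
  lra.
have e3 : 0 < e / 3 by rewrite divr_gt0.
have h0 : `|corr a 0 - corr a' 0| <= e / 3.
  by apply: bnd => i; rewrite mxE normr0.
have /cvgrPdist_le/(_ _ e3) := ca'; apply: filterS => k hk.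
have := bnd _ (hz1 k); move: h0 hk; rewrite !ler_norml => /andP[? ?] /andP[? ?] /andP[? ?].
by apply/andP; split; lra.
Qed.

Let good_dct a (a_ : nat -> 'rV[R]_n -> R) h :
  (forall m, good (a_ m)) -> L2loc a -> L2loc h ->
  (forall x, a_ m x @[m --> \oo] --> a x) ->
  (forall m x, `|a_ m x| <= h x) -> good a.
Proof.
move=> ga La Lh aa ah; apply: good_approx => // e e0.
have ah' x : `|a x| <= h x.
  have /cvg_norm := aa x; move=> ca; apply: (ler_cvg_to ca (cvg_cst (h x))).
  by near=> m; exact: ah.
have h0 x : 0 <= h x by apply: le_trans (ah' x).
have La_ m : L2loc (fun x => a x - a_ m x).
  by have := L2locD La (L2locZ (-1) (ga m).1); under eq_fun do rewrite mulN1r.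
have [] := @dominated_convergence _ _ _ mu Q mQ
  (fun m x => ((a x - a_ m x) ^+ 2)%:E) (cst 0%E) (fun x => (4 * h x ^+ 2)%:E).
- move=> m; apply: measurable_funTS; apply/measurable_EFinP; apply: measurable_funX.
  exact: (La_ m).1.
- exact: measurable_cst.
- apply: aeW => x _; apply: cvg_EFin; first exact: nearW.
  have c1 : (a x - a_ m x) @[m --> \oo] --> a x - a x.
    by apply: cvgB => //; exact: cvg_cst.
  by rewrite -[X in _ --> X](mul0r (0 : R)) -(subrr (a x)); exact: (cvgM c1 c1).
- by apply: intgZ => //; exact: (L2loc_intg mQ (@subset_refl _ _)).
- apply: aeW => x m _; rewrite /= lee_fin ger0_norm ?sqr_ge0//.
  have := ah m x; have := ah' x; rewrite !ler_norml => /andP[? ?] /andP[? ?]; nra.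
move=> _ _; rewrite integral0.
move=> /fine_cvg /cvgrPdist_le /(_ e e0)[m _ /(_ m (leqnn _))] /= hm.
exists (a_ m) => //; move: hm; rewrite sub0r normrN; apply: le_trans.
exact: ler_norm.
Unshelve. all: by end_near. Qed.

Let L2loc_indic A : measurable A -> L2loc (\1_A : 'rV[R]_n -> R).
Proof.
move=> mA; have -> : \1_A = (fun x => \1_A x * 1) :> ('rV[R]_n -> R).
  by apply/funext => x; rewrite mulr1.
apply: (@L2loc_bmul _ _ _ _ 1 (measurable_indic mA) _ (@L2loc_cst R n 1)).
by apply: aeW => x; rewrite indicE; case: (_ \in _); rewrite ?normr1 ?normr0.
Qed.

(** The translation is moved to the indicator function, where it converges
    pointwise almost everywhere. *)
Let good_stable A : measurable A -> stable A -> good (\1_A).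
Proof.
move=> mA sA; split; first exact: L2loc_indic.
pose AQ := A `&` Q; have mAQ : measurable AQ by exact: measurableI.
have corrE z : corr \1_A z = \int[mu]_x (\1_AQ (x - z) * b x).
  rewrite /corr Rintegral_mkcond -[RHS](Rintegral_shift z); last first.
    apply: measurable_funM; last exact: Lb.1.
    exact: measurableT_comp (measurable_indic mAQ) (measurable_shift (- z)).
  apply: eq_Rintegral => x _; rewrite patchE addrK /AQ indicI /= !indicE.
  by case: ifP => _; rewrite ?mulr1 ?mulr0 ?mul0r.
under eq_cvg do rewrite corrE.
rewrite corrE; have mQ1 := @measurable_cube R n (M + 1).
have [] := @dominated_convergence _ _ _ mu setT measurableT
  (fun k x => (\1_AQ (x - z_ k) * b x)%:E) (fun x => (\1_AQ (x - 0) * b x)%:E)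
  (fun x => ((fun x => `|b x|) \_ (cube (M + 1)) x)%:E).
- move=> k; apply/measurable_EFinP; apply: measurable_funM; last exact: Lb.1.
  exact: measurableT_comp (measurable_indic mAQ) (measurable_shift (- z_ k)).
- apply/measurable_EFinP; apply: measurable_funM; last exact: Lb.1.
  exact: measurableT_comp (measurable_indic mAQ) (measurable_shift (- 0)).
- have := stable_setI sA (@stable_cube M); rewrite /stable.
  apply: filterS => x sx _.
  apply: cvg_EFin; first exact: nearW.
  apply: cvg_near_cst; apply: filterS sx => k sk /=.
  rewrite subr0 !indicE; congr (_%:R * _); congr nat_of_bool.
  by apply/idP/idP; rewrite !inE => /sk.
- have : mu.-integrable (cube (M + 1)) (EFin \o (fun x => `|b x|)).
    apply: integrable_norm.
    have := L2loc_mul_intg mQ1 (@subset_refl _ _) Lb (@L2loc_cst R n 1).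
    by under eq_fun do rewrite mulr1.
  move/(integrable_mkcond _ mQ1).1; apply: eq_integrable => // x _.
  by rewrite /= !patchE; case: ifP.
- apply: aeW => x k _; rewrite /= lee_fin normrM patchE.
  case: ifPn => [_|nx].
    by rewrite ler_piMl// indicE; case: (_ \in _); rewrite ?normr1 ?normr0.
  rewrite indicE memNset ?normr0 ?mul0r// => -[_ hx].
  move: nx; rewrite mem_set// => i.
  have := hx i; have := hz1 k i; rewrite !in_itv/= !mxE ler_norml; lra.
move=> i0 _ h.
have := @fine_cvg _ _ _ _ _ (\int[mu]_x (\1_AQ (x - 0) * b x)).
apply; rewrite /Rintegral fineK//.
exact: integrable_fin_num i0.
Qed.

(** Stable sets form a generating family closed under intersection, and good
    indicators are stable under complement and disjoint union: this is Dynkin's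
    lemma. *)
Let good_measurable A : measurable A -> good (\1_A).
Proof.
rewrite stable_generates; move: A; apply: dynkin_induction.
- exact: stable_generates.
- by move=> A A' [mA sA] [mA' sA']; split; [exact: measurableI|exact: stable_setI].
- by apply: good_stable => //; rewrite /stable; apply: aeW => x; exact: nearW.
- by move=> A [mA sA]; exact: good_stable.
- move=> A mA gA; have gT : good (\1_setT).
    by apply: good_stable => //; rewrite /stable; apply: aeW => x; exact: nearW.
  have := goodD gT (goodZ (-1) gA); congr good; apply/funext => x.
  by rewrite indicC indicT indicE /=; case: (x \in A) => /=; ring.
- move=> F mF tF gF.
  have sumE m x j : F j x -> \sum_(i < m) \1_(F i) x = ((j < m)%N)%:R :> R.
    move=> Fx; have eqj i : \1_(F i) x = (i == j)%:R :> R.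
      rewrite indicE; congr (nat_of_bool _)%:R; apply/idP/eqP => [|->]; rewrite inE//.
      by move=> Fix_; apply: (tF i j) => //; exists x.
    under eq_bigr do rewrite eqj.
    case: ltnP => [jm|mj].
      by rewrite (bigD1 (Ordinal jm))//= eqxx big1 ?addr0// => i; rewrite -val_eqE /= => /negbTE->.
    by rewrite big1// => i _; rewrite ltn_eqF// (leq_trans (ltn_ord i) mj).
  have mU : measurable (\bigcup_k F k) by exact: bigcup_measurable.
  apply: (@good_dct _ (fun m x => \sum_(i < m) \1_(F i) x) (fun=> 1)).
  + by move=> m; exact: good_sum.
  + exact: L2loc_indic.
  + exact: L2loc_cst.
  + move=> x; case: (pselect ((\bigcup_k F k) x)) => [Ux|nUx].
      have [j _ Fj] := Ux; rewrite indicE mem_set//.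
      apply: cvg_near_cst; exists j.+1 => // m /= jm.
      by rewrite (sumE m x j Fj) jm.
    rewrite indicE memNset//; apply: cvg_near_cst; apply: nearW => m.
    rewrite big1// => i _; rewrite indicE memNset// => Fi.
    by apply: nUx; exists i.
  + move=> m x; case: (pselect ((\bigcup_k F k) x)) => [[j _ Fj]|nUx].
      by rewrite (sumE m x j Fj); case: ltnP; rewrite ?normr1 ?normr0.
    rewrite big1 ?normr0// => i _; rewrite indicE memNset// => Fi.
    by apply: nUx; exists i.
Qed.

Import HBNNSimple.

(** Simple functions increasing to [a]. *)
Let good_ge0 a : L2loc a -> (forall x, 0 <= a x) -> good a.
Proof.
move=> La a0; have mEa : measurable_fun setT (EFin \o a) by apply/measurable_EFinP; exact: La.1.
pose g := nnsfun_approx measurableT mEa.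
apply: (@good_dct a (fun m => g m : 'rV[R]_n -> R) a) => //.
- move=> m.
  rewrite (funext (fimfunEord (g m))).
  apply: good_sum => i; apply: goodZ; apply: good_measurable.
  exact: measurable_sfunP.
- move=> x; have /fine_cvg := cvg_nnsfun_approx measurableT mEa (fun x _ => a0 x) (I : setT x).
  by move=> h; exact: h.
- move=> m x; rewrite ger0_norm// -lee_fin /g nnsfun_approxE.
  by apply: le_approx => // y _; rewrite lee_fin.
Qed.

Lemma correlation_cvg_cube a : L2loc a ->
  \int[mu]_(x in Q) (a x * b (x + z_ k)) @[k --> \oo] --> \int[mu]_(x in Q) (a x * b x).
Proof.
move=> La; suff [_] : good a by rewrite /corr; under [X in _ --> X]eq_Rintegral do rewrite addr0.
have le_maxr0 (t : R) : 0 <= Num.max t 0 by rewrite le_max lexx orbT.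
have gp := good_ge0 (L2loc_max0 La) (fun x => le_maxr0 _).
have gn := good_ge0 (L2loc_max0 (L2locZ (-1) La)) (fun x => le_maxr0 _).
have := goodD gp (goodZ (-1) gn); congr good; apply/funext => x.
by rewrite !mulN1r; case: (leP 0 (a x)); case: (leP 0 (- a x)); lra.
Qed.

End fixed_field.

End correlation_continuity.

(** * Smooth bump functions *)

Section smooth_functions.
Variable R : realType.
Implicit Types f g : R -> R.

Fixpoint smooth (n : nat) f : Prop :=
  match n with
  | 0 => continuous f
  | n'.+1 => exists2 f' : R -> R, (forall x : R, is_derive x (1 : R) f (f' x)) & smooth n' f'
  end.

Lemma is_derive_continuous f f' : (forall x : R, is_derive x (1 : R) f (f' x)) -> continuous f.
Proof.
move=> df x; apply: differentiable_continuous.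
by apply/derivable1_diffP; have [] := df x.
Qed.

Lemma smooth_continuous n f : smooth n f -> continuous f.
Proof. by case: n => [//|n] [f' /is_derive_continuous]. Qed.

Lemma smoothS n f : smooth n.+1 f -> smooth n f.
Proof.
elim: n f => [|n IH] f; first by move=> [f' /is_derive_continuous].
by move=> [f' df /IH sf']; exists f'.
Qed.

Lemma smoothD n f g : smooth n f -> smooth n g -> smooth n (fun t => f t + g t).
Proof.
elim: n f g => [|n IH] f g.
  by move=> cf cg x; apply: cvgD; [exact: cf|exact: cg].
move=> [f' df sf] [g' dg sg]; exists (fun t => f' t + g' t); last exact: IH.
by move=> x; apply: is_deriveD.
Qed.

Lemma smoothZ n c f : smooth n f -> smooth n (fun t => c * f t).
Proof.
elim: n f => [|n IH] f; first by move=> cf x; apply: cvgMr; exact: cf.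
move=> [f' df sf]; exists (fun t => c * f' t); last exact: IH.
by move=> x; apply: is_deriveZ.
Qed.

Lemma is_deriveM_real f g (x df dg : R) : is_derive x (1 : R) f df -> is_derive x (1 : R) g dg ->
  is_derive x (1 : R) (fun t => f t * g t) (df * g x + f x * dg).
Proof.
move=> hf hg; apply: is_derive_eq (is_deriveM hf hg) _.
by rewrite addrC /GRing.scale /=; ring.
Qed.

Lemma smoothM n f g : smooth n f -> smooth n g -> smooth n (fun t => f t * g t).
Proof.
elim: n f g => [|n IH] f g.
  by move=> cf cg x; apply: cvgM; [exact: cf|exact: cg].
move=> sf sg; have sf' := smoothS sf; have sg' := smoothS sg.
case: sf sg => f' df sf [g' dg sg].
exists (fun t => f' t * g t + f t * g' t); first by move=> x; exact: is_deriveM_real.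
by apply: smoothD; exact: IH.
Qed.

Lemma is_derive_affine f (x s c df : R) : is_derive (s * x + c) (1 : R) f df ->
  is_derive x (1 : R) (fun t => f (s * t + c)) (s * df).
Proof.
move=> hf.
have ha : is_derive x (1 : R) (fun t => s * t + c) s.
  have h1 := is_deriveZ s (is_derive_id x (1 : R)).
  have h2 := is_deriveD h1 (is_derive_cst c x (1 : R)).
  by apply: is_derive_eq h2 _; rewrite addr0 /GRing.scale /= mulr1.
by apply: is_derive_eq (@is_derive1_comp R f (fun t => s * t + c) x df s hf ha) _; rewrite mulrC.
Qed.

Lemma smooth_affine n f s c : smooth n f -> smooth n (fun t => f (s * t + c)).
Proof.
elim: n f => [|n IH] f.
  move=> cf x; apply: continuous_comp; last exact: cf.
  by apply: cvgD; [apply: cvgMr; exact: cvg_id|exact: cvg_cst].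
move=> [f' df sf]; exists (fun t => s * f' (s * t + c)).
  by move=> x; apply: is_derive_affine.
by apply: smoothZ; exact: IH.
Qed.

(** The span of these functions is stable under differentiation, which makes
    [flat 0], that is [exp (- 1 / t)] continued by [0], smooth. *)
Definition flat (k : nat) (t : R) : R := if 0 < t then t ^- k * expR (- t^-1) else 0.

Lemma flat_ge0 k t : 0 <= flat k t.
Proof.
rewrite /flat; case: ifP => // t0.
by rewrite mulr_ge0 ?expR_ge0// invr_ge0 exprn_ge0// ltW.
Qed.

Lemma flat_gt0 k t : 0 < t -> 0 < flat k t.
Proof. by move=> t0; rewrite /flat t0 mulr_gt0 ?expR_gt0// invr_gt0 exprn_gt0. Qed.

Lemma flat_le0 k t : t <= 0 -> flat k t = 0.
Proof. by rewrite /flat leNgt => /negbTE ->. Qed.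

(** From [exp u >= u ^ n / n!] at [u = 1 / t]; a quadratic bound is what makes the
    derivative at [0] vanish. *)
Lemma flat_le k t : flat k t <= (k.+2)`!%:R * t ^+ 2.
Proof.
rewrite /flat; case: ifP => t0; last by rewrite mulr_ge0// sqr_ge0.
have u0 : 0 <= t^-1 by rewrite invr_ge0 ltW.
have f0 : 0 < (k.+2)`!%:R :> R by rewrite ltr0n fact_gt0.
have := expR_ge1Dxn k.+1 u0.
rewrite expRN => h.
have {}h : t^-1 ^+ k.+2 / (k.+2)`!%:R <= expR t^-1 by apply: le_trans h; rewrite lerDr.
have tn0 : t != 0 by rewrite gt_eqF.
rewrite ler_pdivrMr ?expR_gt0//.
apply: le_trans (ler_wpM2l _ h); last by rewrite mulr_ge0// sqr_ge0.
rewrite [leRHS](_ : _ = t ^- k)// exprVn !exprS.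
by field; rewrite expf_neq0// tn0 (gt_eqF f0).
Qed.

Lemma is_derive_flat k t :
  is_derive t (1 : R) (flat k) (- k%:R * flat k.+1 t + flat k.+2 t).
Proof.
case: (ltgtP t 0) => [t0|t0|->].
- rewrite !flat_le0 ?ltW// mulr0 addr0.
  apply: (@near_eq_is_derive _ _ _ (cst 0)).
  near=> s; rewrite /= flat_le0//; apply/ltW.
  by near: s; exact: lt_nbhsl.
- have tn0 : t != 0 by rewrite gt_eqF.
  have dV : is_derive t (1 : R) (fun s => s^-1) (- t ^- 2).
    apply: is_derive_eq (is_deriveV tn0 (is_derive_id t (1 : R))) _.
    by rewrite /GRing.scale /= mulr1.
  have dE : is_derive t (1 : R) (fun s => expR (- s^-1)) (t ^- 2 * expR (- t^-1)).
    apply: is_derive_eq (@is_derive1_comp R expR (fun s => - s^-1) t _ _ (is_derive_expR _) (is_deriveN dV)) _.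
    by rewrite opprK mulrC.
  have dX : is_derive t (1 : R) (fun s => s^-1 ^+ k) (- (k%:R * t^-1 ^+ k.-1 * t ^- 2)).
    have := is_deriveX k dV; rewrite exprfctE => dX; apply: is_derive_eq dX _.
    by rewrite /GRing.scale /= -mulr_natl mulrN.
  have flatE : \near t, t^-1 ^+ k * expR (- t^-1) = flat k t.
    near=> s; rewrite /flat (_ : 0 < s) ?exprVn//.
    by near: s; exact: lt_nbhsr.
  apply: (near_eq_is_derive flatE (is_derive_eq (is_deriveM_real dX dE) _)).
  rewrite /flat t0 !exprVn !exprS /GRing.scale /=; case: k {dX flatE} => [|k].
    by rewrite !mulr0n /=; field.
  by rewrite exprS -mulr_natl /=; field; rewrite expf_neq0.
- rewrite !flat_le0// mulr0 addr0.
  pose C : R := (k.+2)`!%:R; have C0 : 0 < C by rewrite ltr0n fact_gt0.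
  have cvg0 : (fun h : R => h^-1 *: ((flat k \o shift 0) (h *: (1 : R)) - flat k 0)) @ 0^' --> (0 : R).
    apply/cvgrPdist_le => e e0; near=> h.
    rewrite sub0r normrN (flat_le0 _ (lexx 0)) subr0 /= addr0 /GRing.scale /= mulr1.
    have h0 : h != 0 by near: h; exact: nbhs_dnbhs_neq.
    rewrite normrM normfV ler_pdivrMl ?normr_gt0// ger0_norm ?flat_ge0//.
    apply: le_trans (flat_le k h) _.
    have -> : h ^+ 2 = `|h| * `|h| by rewrite -expr2 real_normK ?num_real.
    rewrite mulrCA; apply: ler_wpM2l => //.
    rewrite -ler_pdivlMl//.
    by near: h; apply: dnbhs0_le; rewrite mulr_gt0 ?invr_gt0.
  apply: DeriveDef; first by apply/cvg_ex; exists 0.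
  exact: cvg_lim cvg0.
Unshelve. all: by end_near. Qed.

Lemma smooth_flat n k : smooth n (flat k).
Proof.
elim: n k => [|n IH] k; first exact: is_derive_continuous (is_derive_flat k).
exists (fun t => - k%:R * flat k.+1 t + flat k.+2 t); first exact: is_derive_flat.
by apply: smoothD => //; exact: smoothZ.
Qed.

End smooth_functions.

Section bump_functions.
Variables (R : realType) (d : nat).
Local Notation mu := (lebesgue_rV R d).
Implicit Types g : 'I_d -> R -> R.

Definition prodfun g (x : 'rV[R]_d) : R := \prod_i g i (x 0 i).

Lemma continuous_prodfun g : (forall i, continuous (g i)) -> continuous (prodfun g).
Proof.
move=> cg; suff h (s : seq 'I_d) : continuous (fun x : 'rV[R]_d => \prod_(i <- s) g i (x 0 i)).
  exact: h.
elim: s => [|i s IH].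
  by under eq_fun do rewrite big_nil; exact: cst_continuous.
under eq_fun do rewrite big_cons; move=> x; apply: continuousM; last exact: IH.
by apply: continuous_comp; [exact: coord_continuous|exact: cg].
Qed.

Lemma measurable_prodfun g : (forall i, continuous (g i)) ->
  measurable_fun setT (prodfun g).
Proof.
move=> cg; apply: measurable_prod => i _.
apply: measurableT_comp (measurable_coord i).
exact: continuous_measurable_fun.
Qed.

(** Only one factor varies along a coordinate direction. *)
Lemma is_derive_prodfun g j (x : 'rV[R]_d) dg : is_derive (x 0 j) (1 : R) (g j) dg ->
  is_derive x (delta_mx 0 j) (prodfun g) (dg * \prod_(i | i != j) g i (x 0 i)).
Proof.
move=> hg; pose c := \prod_(i | i != j) g i (x 0 i).
have E h : prodfun g (h *: delta_mx 0 j + x) = c * g j (h *: (1 : R) + x 0 j).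
  rewrite /prodfun (bigD1 j)//= mulrC; congr (_ * g j _).
    apply: eq_bigr => i ij; rewrite !mxE eqxx (negbTE ij) /=.
    by rewrite mulr0 add0r.
  by rewrite !mxE !eqxx /GRing.scale /= mulr1.
have E0 : prodfun g x = c * g j (x 0 j).
  by rewrite -[x in LHS]add0r -[0 in LHS](scale0r (delta_mx 0 j)) E scale0r add0r.
have Q : (fun h : R => h^-1 *: ((prodfun g \o shift x) (h *: delta_mx 0 j) - prodfun g x)) =
   (fun h : R => h^-1 *: (((fun t => c * g j t) \o shift (x 0 j)) (h *: (1 : R)) - c * g j (x 0 j))).
  by apply/funext => h /=; rewrite E E0.
have := is_deriveZ c hg; rewrite mulrC -/c => -[hd hv].
apply: DeriveDef; first by rewrite /derivable Q.
by rewrite /derive Q.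
Qed.

Lemma Cn_prodfun n g : (forall i, smooth n (g i)) -> Cn n (prodfun g).
Proof.
elim: n g => [|n IH] g sg.
  by split => //; apply: continuous_prodfun => i; exact: sg.
split; first by apply: continuous_prodfun => i; exact: smooth_continuous (sg i).
move=> j; have [g' dg' sg'] := sg j.
have D (x : 'rV[R]_d) := is_derive_prodfun (dg' (x 0 j)).
split => [x|]; first by have [] := D x.
have -> : partial j (prodfun g) = prodfun (fun i => if i == j then g' else g i).
  apply/funext => x; rewrite /partial (@derive_val _ _ _ _ _ _ _ (D x)).
  rewrite /prodfun [RHS](bigD1 j)//= eqxx; congr (_ * _).
  by apply: eq_bigr => i /negbTE ->.
by apply: IH => i; case: eqP => // _; exact: smoothS.
Qed.

Definition bump1 (e t : R) := flat 0 (e + t) * flat 0 (e - t).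

Definition dbump1 (e t : R) := flat 2 (e + t) * flat 0 (e - t) - flat 0 (e + t) * flat 2 (e - t).

Definition bump (e : R) : 'rV[R]_d -> R := prodfun (fun=> bump1 e).

Definition dbump (e : R) (j : 'I_d) : 'rV[R]_d -> R :=
  prodfun (fun i => if i == j then dbump1 e else bump1 e).

Lemma smooth_flatD n k e : smooth n (fun t : R => flat k (e + t)).
Proof.
have := smooth_affine 1 e (smooth_flat R n k); congr smooth.
by apply/funext => t; rewrite mul1r addrC.
Qed.

Lemma smooth_flatB n k e : smooth n (fun t : R => flat k (e - t)).
Proof.
have := smooth_affine (-1) e (smooth_flat R n k); congr smooth.
by apply/funext => t; rewrite mulN1r addrC.
Qed.

Lemma smooth_bump1 n e : smooth n (bump1 e).
Proof. by apply: smoothM; [exact: smooth_flatD|exact: smooth_flatB]. Qed.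

Lemma is_derive_bump1 e t : is_derive t (1 : R) (bump1 e) (dbump1 e t).
Proof.
have f0 s : is_derive s (1 : R) (flat 0) (flat 2 s).
  by apply: is_derive_eq (is_derive_flat 0 s) _; rewrite oppr0 mul0r add0r.
have h1 : is_derive t (1 : R) (fun t => flat 0 (e + t)) (flat 2 (e + t)).
  have -> : (fun t => flat 0 (e + t)) = (fun t => flat 0 (1 * t + e)).
    by apply/funext => u; rewrite mul1r addrC.
  by apply: is_derive_eq (is_derive_affine (f0 _)) _; rewrite !mul1r addrC.
have h2 : is_derive t (1 : R) (fun t => flat 0 (e - t)) (- flat 2 (e - t)).
  have -> : (fun t => flat 0 (e - t)) = (fun t => flat 0 (-1 * t + e)).
    by apply/funext => u; congr (flat 0 _); ring.
  apply: is_derive_eq (is_derive_affine (f0 _)) _.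
  by rewrite mulN1r; congr (- flat 2 _); ring.
apply: is_derive_eq (is_deriveM_real h1 h2) _.
by rewrite /dbump1 mulrN.
Qed.

Lemma continuous_dbump1 e : continuous (dbump1 e).
Proof.
have h1 : smooth 0 (fun t => flat 2 (e + t) * flat 0 (e - t)).
  by apply: smoothM; [exact: smooth_flatD|exact: smooth_flatB].
have h2 : smooth 0 (fun t => flat 0 (e + t) * flat 2 (e - t)).
  by apply: smoothM; [exact: smooth_flatD|exact: smooth_flatB].
have := smoothD h1 (smoothZ (-1) h2).
suff -> : (fun t => flat 2 (e + t) * flat 0 (e - t) +
    -1 * (flat 0 (e + t) * flat 2 (e - t))) = dbump1 e by [].
by apply/funext => t; rewrite /dbump1 mulN1r.
Qed.

Lemma bump1_out e t : ~~ (t \in `[- e, e]) -> bump1 e t = 0.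
Proof.
rewrite in_itv/= negb_and -!ltNge /bump1 => /orP[] h.
  by rewrite (@flat_le0 _ _ (e + t)) ?mul0r//; lra.
by rewrite (@flat_le0 _ _ (e - t)) ?mulr0//; lra.
Qed.

Lemma dbump1_out e t : ~~ (t \in `[- e, e]) -> dbump1 e t = 0.
Proof.
rewrite in_itv/= negb_and -!ltNge /dbump1 => /orP[] h.
  by rewrite !(@flat_le0 _ _ (e + t)) ?mul0r ?subrr//; lra.
by rewrite !(@flat_le0 _ _ (e - t)) ?mulr0 ?subrr//; lra.
Qed.

Lemma prodfun_out g e x : (forall i t, ~~ (t \in `[- e, e]) -> g i t = 0) ->
  ~ cube e x -> prodfun g x = 0.
Proof.
move=> gout; apply: contra_notP => /eqP/prodf_neq0 nz i.
by have := nz i isT; apply: contraNT => /gout ->.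
Qed.

Lemma continuous_kernel (k : 'rV[R]_d -> R) N : continuous k -> measurable_fun setT k ->
  (forall x, ~ cube N x -> k x = 0) -> bounded_kernel k.
Proof.
move=> ck mk kN; split => //.
have : compact (k @` cube N).
  by apply: continuous_compact; [exact: continuous_subspaceT|exact: compact_cube].
move=> /compact_bounded[M [_ hM]]; exists (`|M| + 1), N; split => // x.
have [Nx|/kN ->] := pselect (cube N x); last by rewrite normr0 addr_ge0.
apply: hM; last by exists x.
by rewrite (le_lt_trans (ler_norm _))// ltrDl.
Qed.

Lemma bounded_kernel_opp (k : 'rV[R]_d -> R) :
  bounded_kernel k -> bounded_kernel (fun x => k (- x)).
Proof.
move=> [mk [C [N [kC kN]]]]; split.
  apply: measurableT_comp mk _; have := @measurable_affine R d (-1) 0.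
  by under eq_fun do rewrite scaleN1r addr0.
exists C, N; split => // x xN; apply: kN; apply: contra_not xN => h i.
by have := h i; rewrite !in_itv/= mxE; lra.
Qed.

Lemma bump_kernel e : bounded_kernel (bump e).
Proof.
have cb (i : 'I_d) : continuous (bump1 e) by exact: smooth_continuous (smooth_bump1 0 e).
apply: (@continuous_kernel _ e).
- exact: continuous_prodfun.
- exact: measurable_prodfun.
- by move=> x; apply: prodfun_out => i t; exact: bump1_out.
Qed.

Lemma dbump_kernel e j : bounded_kernel (dbump e j).
Proof.
have cb (i : 'I_d) : continuous (if i == j then dbump1 e else bump1 e).
  case: ifP => _; first exact: continuous_dbump1.
  exact: smooth_continuous (smooth_bump1 0 e).
apply: (@continuous_kernel _ e).
- exact: continuous_prodfun.
- exact: measurable_prodfun.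
- move=> x; apply: prodfun_out => i t; case: ifP => _; [exact: dbump1_out|exact: bump1_out].
Qed.

Lemma bump_ge0 e x : 0 <= bump e x.
Proof. by apply: prodr_ge0 => i _; rewrite mulr_ge0// flat_ge0. Qed.

Lemma bump_out e x : ~ cube e x -> bump e x = 0.
Proof. by apply: prodfun_out => i t; exact: bump1_out. Qed.

Lemma bump_gt0 e x : 0 < e -> cube (e / 2) x -> 0 < bump e x.
Proof.
move=> e0 h; apply: prodr_gt0 => i _; have := h i; rewrite in_itv/= => /andP[? ?].
by rewrite mulr_gt0// flat_gt0//; lra.
Qed.

(** Both [x |-> bump e (x - y)] and [y |-> bump e (x - y)] serve as test functions,
    the former against the stress and the latter against the displacement. *)
Lemma test_bump e (s : R) (c : 'rV[R]_d) : is_sign s ->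
  test_function (fun x => bump e (s *: x + c)) /\
  forall j x, partial j (fun x => bump e (s *: x + c)) x = s * dbump e j (s *: x + c).
Proof.
move=> hs; have E : (fun x => bump e (s *: x + c)) =
    prodfun (fun i t => bump1 e (s * t + c 0 i)).
  by apply/funext => x; apply: eq_bigr => i _; rewrite !mxE.
rewrite E; split; last first.
  move=> j x; have D := is_derive_prodfun (g := fun i t => bump1 e (s * t + c 0 i))
    (is_derive_affine (is_derive_bump1 e (s * x 0 j + c 0 j))).
  rewrite /partial (@derive_val _ _ _ _ _ _ _ D) -mulrA; congr (_ * _).
  rewrite /dbump /prodfun [RHS](bigD1 j)//= eqxx !mxE; congr (_ * _).
  by apply: eq_bigr => i /negbTE ->; rewrite !mxE.
split => [n|].
  by apply: Cn_prodfun => i; apply: smooth_affine; exact: smooth_bump1.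
exists (cube (e + \sum_i `|c 0 i|)); first exact: compact_cube.
move=> x; rewrite -E; apply: contra_notP => /eqP/prodf_neq0 nz i.
have := nz i isT; apply: contraNT => nx; apply/eqP; apply: bump1_out.
apply: contraNN nx; rewrite !mxE !in_itv/= => /andP[h1 h2].
have ci : `|c 0 i| <= \sum_i `|c 0 i| by rewrite (bigD1 i)//= lerDl sumr_ge0.
by move: ci; rewrite ler_norml => /andP[h3 h4]; case: hs h1 h2 => ->; lra.
Qed.

End bump_functions.

(** * Orthogonality of strains and stresses *)

Section orthogonality.
Variables (R : realType) (d : nat) (B : 'M[R]_d).
Hypothesis hB : B \in unitmx.
Local Notation mu := (lebesgue_rV R d).
Local Notation P := (parallelepiped B).
Implicit Types (a b w : 'rV[R]_d -> R) (e : R).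

Lemma correlation_cvg D M a b (z_ : nat -> 'rV[R]_d) : measurable D -> D `<=` cube M ->
  L2loc a -> L2loc b -> (forall k i, `|z_ k 0 i| <= k.+1%:R^-1) ->
  \int[mu]_(x in D) (a x * b (x + z_ k)) @[k --> \oo] --> \int[mu]_(x in D) (a x * b x).
Proof.
move=> mD DM La Lb hz.
have LaD : L2loc (a \_ D).
  have -> : a \_ D = (fun x => \1_D x * a x).
    by apply/funext => x; rewrite patch_indic mulrC.
  apply: (@L2loc_bmul _ _ _ _ 1); [exact: measurable_indic| |exact: La].
  by apply: aeW => x; rewrite indicE; case: (_ \in _); rewrite ?normr1 ?normr0.
have E f : \int[mu]_(x in cube M) ((a \_ D) x * f x) = \int[mu]_(x in D) (a x * f x).
  rewrite Rintegral_mkcond [RHS]Rintegral_mkcond; apply: eq_Rintegral => x _.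
  rewrite !patchE; case: ifPn => Mx; case: ifPn => Dx //; rewrite ?mul0r//.
  by move: Mx; rewrite mem_set//; apply: DM; rewrite inE in Dx.
have := @correlation_cvg_cube R d z_ hz b M Lb _ LaD.
by under eq_cvg do rewrite E; rewrite E.
Qed.

Lemma bump_intg e : mu.-integrable setT (EFin \o (fun z => bump e (- z))).
Proof.
have := kernel_intg (bounded_kernel_opp (bump_kernel d e)) (@L2loc_cst R d 1).
by under eq_fun do rewrite mul1r.
Qed.

Lemma bump_integral_gt0 e : 0 < e -> 0 < \int[mu]_z bump e (- z).
Proof.
move=> e0; have ib := bump_intg e.
have b0 z : 0 <= bump e (- z) by exact: bump_ge0.
rewrite lt0r Rintegral_ge0// andbT; apply/eqP => I0.
have : (\int[mu]_z `|(bump e (- z))%:E| = 0)%E.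
  under eq_integral do rewrite gee0_abs ?lee_fin//.
  by rewrite -[LHS](fineK (integrable_fin_num measurableT ib)) [fine _]I0.
move/(ae_eq_integral_abs mu measurableT (measurable_int mu ib)).1 => [N [mN N0 sN]].
have := cube_gt0 d (divr_gt0 e0 (@ltr0Sn R 1)); suff -> : mu (cube (e / 2)) = 0%E by rewrite ltxx.
apply: (subset_measure0 (@measurable_cube R d (e / 2)) mN _ N0).
move=> z cz; apply: sN => /= /(_ I) [] /eqP.
rewrite gt_eqF//; apply: bump_gt0 => // i.
by have := cz i; rewrite !in_itv/= mxE; lra.
Qed.

(** A value [c 0 <> 0] would dominate the average of [c] against a sufficiently
    concentrated bump. *)
Lemma bump_separates (c : 'rV[R]_d -> R) :
  (forall z_ : nat -> 'rV[R]_d, (forall k i, `|z_ k 0 i| <= k.+1%:R^-1) ->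
     c (z_ k) @[k --> \oo] --> c 0) ->
  (forall e, mu.-integrable setT (EFin \o (fun z => bump e (- z) * c z)) /\
     \int[mu]_z (bump e (- z) * c z) = 0) ->
  c 0 = 0.
Proof.
move=> cc ic; apply/eqP; apply: contraT => c0; exfalso.
have n0 : 0 < `|c 0| / 2 by rewrite divr_gt0// normr_gt0.
have hex (k : nat) : exists z : 'rV[R]_d,
    (forall i, `|z 0 i| <= k.+1%:R^-1) /\ `|c 0| / 2 <= `|c 0 - c z|.
  (* Otherwise [c] keeps the sign of [c 0] on the support of a bump. *)
  apply: contrapT => /forallNP nz; pose e : R := k.+1%:R^-1.
  have e0 : 0 < e by rewrite invr_gt0.
  have [i1 i2] := ic e; have p0 := bump_integral_gt0 e0; have ib := bump_intg e.
  have : \int[mu]_z (c 0 ^+ 2 / 2 * bump e (- z)) <= \int[mu]_z (c 0 * (bump e (- z) * c z)).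
    apply: le_Rintegral => //; [exact: intgZ|exact: intgZ|move=> z _].
    have [cz|ncz] := pselect (cube e (- z)); last by rewrite bump_out// mulr0 mul0r mulr0.
    rewrite mulrCA [leLHS]mulrC; apply: ler_wpM2l; first exact: bump_ge0.
    have /not_andP[h|/negP] := nz z.
      exfalso; apply: h => i; have := cz i.
      by rewrite in_itv/= mxE -/e ler_norml; lra.
    rewrite -ltNge => h.
    have h1 : `|c 0 * (c 0 - c z)| <= `|c 0| * (`|c 0| / 2) by rewrite normrM ler_wpM2l// ltW.
    have h2 : `|c 0| * (`|c 0| / 2) = c 0 ^+ 2 / 2 by rewrite mulrA -expr2 real_normK ?num_real.
    by move: h1; rewrite h2 ler_norml; nra.
  rewrite !RintegralZl// i2 mulr0 leNgt mulr_gt0//.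
  by rewrite divr_gt0// exprn_even_gt0.
have [z_ hz] := choice hex.
have := cc z_ (fun k => (hz k).1) => /cvgrPdist_lt/(_ _ n0)[N _ /(_ N (leqnn _))] /=.
by rewrite ltNge (hz N).2.
Qed.

Lemma bounded_kernel_shift (k : 'rV[R]_d -> R) (c : 'rV[R]_d) :
  bounded_kernel k -> bounded_kernel (fun x => k (x + c)).
Proof.
move=> [mk [C [N [kC kN]]]]; split.
  exact: measurableT_comp mk (measurable_shift c).
exists C, (N + \sum_i `|c 0 i|); split => // x xN; apply: kN.
apply: contra_not xN => h i.
have ci : `|c 0 i| <= \sum_i `|c 0 i| by rewrite (bigD1 i)//= lerDl sumr_ge0.
by move: ci; have := h i; rewrite !in_itv/= mxE ler_norml; lra.
Qed.

(** The derivative moves from the stress to the displacement through the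
    kernel; no field is differentiated. *)
Lemma divergence_free_correlation e (s : 'I_d -> 'rV[R]_d -> R) w (W : 'I_d -> 'rV[R]_d -> R) :
  (forall j, L2per B (s j)) -> L2per B w ->
  (forall j, L2loc (W j) /\ weak_partial j w (W j)) ->
  (forall phi, test_function phi -> \int[mu]_x (\sum_j s j x * partial j phi x) = 0) ->
  \sum_j \int[mu]_z (bump e (- z) * \int[mu]_(x in P) (s j x * W j (x + z))) = 0.
Proof.
move=> Ls [Lw pw] hW divs.
have mP := measurable_parallelepiped B; have [M PM] := parallelepiped_bounded hB.
have Lsl j := (Ls j).1.
pose T j := \int[mu]_(y in P) (w y * \int[mu]_x (s j x * dbump e j (x - y))).
have T0 : \sum_j T j = 0.
  rewrite -Rintegral_sum//; last first.
    by move=> j; have [] := correlation_swap mP PM Lw (Lsl j) (dbump_kernel e j).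
  transitivity (\int[mu]_(y in P) (0 : R)); last by rewrite Rintegral_cst// mul0r.
  apply: eq_Rintegral => y _; rewrite -mulr_sumr -Rintegral_sum//; last first.
    by move=> j; apply: kernel_intg => //; apply: bounded_kernel_shift; exact: dbump_kernel.
  have [tb pb] := test_bump e (- y) (is_sign1 R).
  rewrite -[RHS](mulr0 (w y)); congr (_ * _); apply: etrans (divs _ tb).
  apply: eq_Rintegral => x _; apply: eq_bigr => j _.
  by rewrite pb mul1r scale1r.
rewrite -[RHS]T0; apply: eq_bigr => j _; rewrite /T.
have [_ i2 ->] := correlation_swap mP PM Lw (Lsl j) (dbump_kernel e j).
have [_ _ <-] := correlation_swap mP PM (Lsl j) (hW j).1 (bounded_kernel_opp (bump_kernel d e)).
(* Translation invariance over the cell moves the shift from [s] to [w]. *)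
have cellE z : \int[mu]_(y in P) (w y * s j (y + z)) = \int[mu]_(x in P) (s j x * w (x - z)).
  rewrite -(@Rintegral_cell_shift _ _ _ hB _ (fun x => s j x * w (x - z)) z (parallelepiped_cell hB)).
  - by apply: eq_Rintegral => x _; rewrite addrK mulrC.
  - apply: measurable_funM; first exact: (Lsl j).1.
    exact: measurableT_comp Lw.1 (measurable_shift (- z)).
  - by apply: (periodic_comp2 *%R (Ls j).2); exact: periodic_shift.
transitivity (\int[mu]_z (dbump e j (- z) * \int[mu]_(x in P) (s j x * w (x + z)))); last first.
  rewrite -[RHS]Rintegral_opp; last by have := measurable_int mu i2 => /measurable_EFinP.
  apply: eq_Rintegral => z _; rewrite cellE; congr (_ * _).
  by apply: eq_Rintegral => x _; rewrite opprK.
have [_ _ <-] := correlation_swap mP PM (Lsl j) Lw (bounded_kernel_opp (dbump_kernel e j)).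
apply: eq_Rintegral => x _; congr (_ * _).
have [tb pb] := test_bump e x (is_signN1 R).
have mb : measurable_fun setT (fun y => W j y * bump e (- (y - x))).
  apply: measurable_funM; first exact: (hW j).1.1.
  exact: measurableT_comp (bounded_kernel_opp (bump_kernel d e)).1 (measurable_shift (- x)).
have bE y : bump e (-1 *: y + x) = bump e (- (y - x)) by rewrite scaleN1r opprB addrC.
have dE y : partial j (fun y => bump e (-1 *: y + x)) y = - dbump e j (- (y - x)).
  by rewrite pb mulN1r scaleN1r opprB addrC.
have := (hW j).2 _ tb.
under eq_Rintegral do rewrite dE mulrN.
under [in RHS]eq_Rintegral do rewrite bE.
move=> h; apply: oppr_inj; rewrite -[LHS]h.
by rewrite -mulN1r -RintegralZl//; [apply: eq_Rintegral => y _; rewrite mulN1r|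
  exact: (kernel_intg (bounded_kernel_shift (- x) (bounded_kernel_opp (dbump_kernel e j))) Lw)].
Qed.

Lemma ddot_sym (s W : 'M[R]_d) : s^T = s -> ddot s (2^-1 *: (W + W^T)) = ddot s W.
Proof.
move=> sT; have E : ddot s W^T = ddot s W.
  rewrite /ddot exchange_big; apply: eq_bigr => i _; apply: eq_bigr => j _.
  by rewrite mxE -{1}sT mxE.
have -> : ddot s (2^-1 *: (W + W^T)) = 2^-1 * (ddot s W + ddot s W^T).
  rewrite /ddot -big_split mulr_sumr; apply: eq_bigr => i _.
  by rewrite -big_split mulr_sumr; apply: eq_bigr => j _; rewrite !mxE /=; ring.
by rewrite E; lra.
Qed.

(** Averaged against any bump, the correlation of [s] with the gradient [W]
    vanishes; it is continuous in the shift, so it vanishes at shift [0], where it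
    is the pairing of [s] with [W], that is with the symmetric part [e] of [W],
    because [s] is symmetric. *)
Lemma strain_stress_orthogonal V (s e : 'rV[R]_d -> 'M[R]_d) : unit_cell B V ->
  Sspace B s -> E0 B e -> \int[mu]_(x in V) ddot (s x) (e x) = 0.
Proof.
move=> cV [[Ls ss] divs] [[Le _] [w [Hw [W hW eW]]]].
have mP := measurable_parallelepiped B; have [M PM] := parallelepiped_bounded hB.
have cP := parallelepiped_cell hB.
have LW i j : L2loc (fun x => W x i j) by have [] := hW i j.
have Lsl i j : L2loc (fun x => s x i j) := (Ls i j).1.
pose c z := \sum_i \sum_j \int[mu]_(x in P) (s x i j * W (x + z) i j).
have c0 : c 0 = 0.
  apply: bump_separates => [z_ hz|e'].
    rewrite /c; apply: cvg_big => [|i _]; first exact: add_continuous.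
    apply: cvg_big => [|j _]; first exact: add_continuous.
    under [X in _ --> X]eq_Rintegral do rewrite addr0.
    exact: (correlation_cvg mP PM (Lsl i j) (LW i j) hz).
  have ij i j : mu.-integrable setT (EFin \o (fun z => bump e' (- z) *
      \int[mu]_(x in P) (s x i j * W (x + z) i j))).
    by have [] := correlation_swap mP PM (Lsl i j) (LW i j) (bounded_kernel_opp (bump_kernel d e')).
  have E z : bump e' (- z) * c z = \sum_i \sum_j (bump e' (- z) *
      \int[mu]_(x in P) (s x i j * W (x + z) i j)).
    by rewrite /c mulr_sumr; apply: eq_bigr => i _; rewrite mulr_sumr.
  split; first by under eq_fun do rewrite E; do 2 apply: intg_sum => // ?.
  under eq_Rintegral do rewrite E.
  rewrite Rintegral_sum//; last by move=> i; exact: intg_sum.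
  rewrite big1// => i _; rewrite Rintegral_sum//.
  apply: (divergence_free_correlation e' (s := fun j x => s x i j) (w := fun x => w x 0 i)
    (W := fun j x => W x i j)) => //.
  - by have [[Lw _] pw] := Hw i.
  - exact: divs.
have me : measurable_fun setT (fun x => ddot (s x) (e x)).
  do 2 apply: measurable_sum => ?.
  by apply: measurable_funM; [exact: (Ls _ _).1.1|exact: (Le _ _).1.1].
rewrite (Rintegral_cell hB cV cP me); last first.
  do 2 apply: periodic_sum => ?.
  by apply: (periodic_comp2 *%R (Ls _ _).2 (Le _ _).2).
rewrite -[RHS]c0 /c.
transitivity (\int[mu]_(x in P) ddot (s x) (W x)).
  apply: ae_eq_Rintegral => //.
  - exact: measurable_funTS.
  - apply: measurable_funTS; do 2 apply: measurable_sum => ?.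
    by apply: measurable_funM; [exact: (Ls _ _).1.1|exact: (LW _ _).1].
  - by apply: filterS2 ss eW => x sx -> _; exact: ddot_sym.
have iW i j := L2loc_mul_intg mP PM (Lsl i j) (LW i j).
rewrite /ddot Rintegral_sum//; last by move=> i; exact: intg_sum.
apply: eq_bigr => i _; rewrite Rintegral_sum//; apply: eq_bigr => j _.
by apply: eq_Rintegral => x _; rewrite addr0.
Qed.

End orthogonality.

(** * The gradient *)

Section tensor_algebra.
Variables (R : realType) (d : nat).
Implicit Types (C : tensor4 R d) (s e : 'M[R]_d) (t : R).

Lemma ddotC s e : ddot s e = ddot e s.
Proof. by apply: eq_bigr => i _; apply: eq_bigr => j _; rewrite mulrC. Qed.

Lemma ddotDl s t s' e : ddot (s + t *: s') e = ddot s e + t * ddot s' e.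
Proof.
rewrite /ddot mulr_sumr -big_split; apply: eq_bigr => i _.
by rewrite mulr_sumr -big_split; apply: eq_bigr => j _; rewrite !mxE /=; ring.
Qed.

Lemma tappD C e t e' : tapp C (e + t *: e') = tapp C e + t *: tapp C e'.
Proof.
apply/matrixP => i j; rewrite !mxE mulr_sumr -big_split; apply: eq_bigr => k _.
by rewrite mulr_sumr -big_split; apply: eq_bigr => l _; rewrite !mxE /=; ring.
Qed.

Lemma tapp_sym C e : minor_symmetries C -> (tapp C e)^T = tapp C e.
Proof.
move=> hC; apply/matrixP => i j; rewrite !mxE.
by apply: eq_bigr => k _; apply: eq_bigr => l _; rewrite (hC j i k l).1.
Qed.

Lemma tapp_adj C s e : major_symmetry C -> ddot (tapp C s) e = ddot s (tapp C e).
Proof.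
move=> hC; rewrite /ddot.
transitivity (\sum_i \sum_j \sum_k \sum_l C i j k l * s k l * e i j).
  apply: eq_bigr => i _; apply: eq_bigr => j _; rewrite mxE mulr_suml.
  by apply: eq_bigr => k _; rewrite mulr_suml.
rewrite [RHS](_ : _ = \sum_k \sum_l \sum_i \sum_j C i j k l * s k l * e i j); last first.
  apply: eq_bigr => k _; apply: eq_bigr => l _; rewrite mxE mulr_sumr.
  apply: eq_bigr => i _; rewrite mulr_sumr; apply: eq_bigr => j _.
  by rewrite (hC i j k l); ring.
rewrite pair_big [RHS]pair_big; under eq_bigr do rewrite pair_big.
under [RHS]eq_bigr do rewrite pair_big.
by rewrite exchange_big.
Qed.

End tensor_algebra.

Section gradient.
Variables (R : realType) (d : nat) (B : 'M[R]_d).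
Hypothesis hB : B \in unitmx.
Variable V : set 'rV[R]_d.
Hypothesis hV : unit_cell B V.
Local Notation mu := (lebesgue_rV R d).
Local Notation field := ('rV[R]_d -> 'M[R]_d).
Implicit Types (s e a b : field) (t : R).

Definition lin a t b : field := fun x => a x + t *: b x.

Lemma Hspace_lin a t b : Hspace B a -> Hspace B b -> Hspace B (lin a t b).
Proof.
move=> [La sa] [Lb sb]; split.
  move=> i j; rewrite /lin; under eq_fun do rewrite !mxE.
  by apply: L2perD => //; exact: L2perZ.
by apply: filterS2 sa sb => x sax sbx; rewrite /lin linearD linearZ /= sax sbx.
Qed.

Lemma Hspace_periodic a : Hspace B a -> Defs.periodic B a.
Proof.
move=> [La _] r Br.
have : {ae mu, forall x, forall p : 'I_d * 'I_d, a (x + r) p.1 p.2 = a x p.1 p.2}.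
  by apply: filter_forall => -[i j]; exact: (La i j).2.
by apply: filterS => x h; apply/matrixP => i j; exact: (h (i, j)).
Qed.

Lemma Hspace_fapp (L : 'rV[R]_d -> tensor4 R d) a :
  elasticity_field B V L -> Hspace B a -> Hspace B (fapp L a).
Proof.
move=> [mL pL sL [M LM] _] [La sa].
have LM' : {ae mu, forall x, forall i j k l, `|L x i j k l| <= M}.
  apply: (ae_cell hB hV) LM => r Br.
  by apply: filterS (pL r Br) => x ->.
split; last by apply: filterS sL => x [_ ms]; exact: tapp_sym.
move=> i j; split.
  rewrite /fapp /tapp; under eq_fun do rewrite mxE.
  apply: L2loc_sum => k; apply: L2loc_sum => l.
  apply: (@L2loc_bmul _ _ _ _ M) => //; last exact: (La k l).1.
  by apply: filterS LM'.
have := periodic_comp2 (fun (C : tensor4 R d) m => tapp C m i j) pL (Hspace_periodic (conj La sa)).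
exact.
Qed.

Lemma Hspace_tapp (C : tensor4 R d) a :
  minor_symmetries C -> Hspace B a -> Hspace B (fun x => tapp C (a x)).
Proof.
move=> mC Ha; have [La sa] := Ha.
split; last by apply: aeW => x; exact: tapp_sym.
move=> i j; split.
  rewrite /tapp; under eq_fun do rewrite mxE.
  by apply: L2loc_sum => k; apply: L2loc_sum => l; apply: L2locZ; exact: (La k l).1.
exact: (periodic_comp (fun m => tapp C m i j) (Hspace_periodic Ha)).
Qed.

Definition pairing s e := \int[mu]_(x in V) ddot (s x) (e x).

Lemma measurable_ddot s e : Hspace B s -> Hspace B e ->
  measurable_fun setT (fun x => ddot (s x) (e x)).
Proof.
move=> [Ls _] [Le _]; do 2 apply: measurable_sum => ?.
by apply: measurable_funM; [exact: (Ls _ _).1.1|exact: (Le _ _).1.1].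
Qed.

Lemma intg_ddot s e : Hspace B s -> Hspace B e ->
  mu.-integrable V (EFin \o (fun x => ddot (s x) (e x))).
Proof.
move=> [Ls _] [Le _]; do 2 apply: (intg_sum hV.1) => ?.
exact: (L2per_mul_intg hB hV).
Qed.

Lemma pairingC s e : pairing s e = pairing e s.
Proof. by apply: eq_Rintegral => x _; exact: ddotC. Qed.

Lemma pairing_linl s t s' e : Hspace B s -> Hspace B s' -> Hspace B e ->
  pairing (lin s t s') e = pairing s e + t * pairing s' e.
Proof.
move=> Hs Hs' He; have mV := hV.1; rewrite /pairing /lin.
under eq_Rintegral do rewrite ddotDl.
rewrite RintegralD//; [|exact: intg_ddot|by apply: intgZ => //; exact: intg_ddot].
by rewrite RintegralZl//; exact: intg_ddot.
Qed.

Lemma pairing_linr s e t e' : Hspace B s -> Hspace B e -> Hspace B e' ->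
  pairing s (lin e t e') = pairing s e + t * pairing s e'.
Proof.
by move=> Hs He He'; rewrite pairingC pairing_linl// ![pairing _ s]pairingC.
Qed.

Lemma pairing_ae s e s' e' : Hspace B s -> Hspace B e -> Hspace B s' -> Hspace B e' ->
  field_eq s s' -> field_eq e e' -> pairing s e = pairing s' e'.
Proof.
move=> Hs He Hs' He' ss ee; apply: ae_eq_Rintegral.
- exact: hV.1.
- by apply: measurable_funTS; exact: measurable_ddot.
- by apply: measurable_funTS; exact: measurable_ddot.
- by apply: filterS2 ss ee => x -> ->.
Qed.

Section reference.
Variable L0 : tensor4 R d.
Hypothesis hL0 : reference_tensor L0.

Let L0a a : field := fun x => tapp L0 (a x).

Let HL0 a : Hspace B a -> Hspace B (L0a a).
Proof. by apply: Hspace_tapp; case: hL0. Qed.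

Let ddot_ge0 a : Hspace B a -> {ae mu, forall x, 0 <= ddot (L0a a x) (a x)}.
Proof.
move=> [_ sa]; apply: filterS sa => x sx; have [_ _ pd] := hL0.
have [->|nz] := eqVneq (a x) 0; last exact/ltW/pd.
rewrite /ddot big1// => i _; rewrite big1// => j _.
by rewrite [X in _ * X]mxE mulr0.
Qed.

Let cell_volume_gt0 : 0 < (fine (mu V))^-1.
Proof. by rewrite invr_gt0 fine_gt0// (cell_gt0 hB hV) (cell_lty hB hV). Qed.

Let inner_HeE a b : inner_He V L0 a b = (fine (mu V))^-1 * pairing (L0a a) b.
Proof. by []. Qed.

Lemma pairing_ge0 a : Hspace B a -> 0 <= pairing (L0a a) a.
Proof.
move=> Ha; rewrite /pairing (_ : \int[mu]_(x in V) _ = \int[mu]_(x in V) `|ddot (L0a a x) (a x)|).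
  by apply: Rintegral_ge0.
have mf := measurable_ddot (HL0 Ha) Ha.
apply: ae_eq_Rintegral; [exact: hV.1|exact: measurable_funTS| |].
  by apply: measurable_funTS; exact: measurableT_comp.
by apply: filterS (ddot_ge0 Ha) => x h _; rewrite ger0_norm.
Qed.

(** The integrand is nonnegative, so it vanishes on the cell, and periodicity
    extends this to the whole space. *)
Lemma pairing_eq0 a : Hspace B a -> pairing (L0a a) a = 0 ->
  {ae mu, forall x, a x = 0}.
Proof.
move=> Ha a0; have mf := measurable_ddot (HL0 Ha) Ha; have mV := hV.1.
apply: (ae_cell hB hV) => [r Br|].
  by apply: filterS (Hspace_periodic Ha Br) => x ->.
have i0 := intg_ddot (HL0 Ha) Ha.
have : (\int[mu]_(x in V) `|(ddot (L0a a x) (a x))%:E| = 0)%E.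
  transitivity (\int[mu]_(x in V) (ddot (L0a a x) (a x))%:E)%E.
    apply: ae_eq_integral => //.
    - by apply: measurableT_comp => //; apply/measurable_EFinP; exact: measurable_funTS.
    - by apply/measurable_EFinP; exact: measurable_funTS.
    - by apply: filterS (ddot_ge0 Ha) => x h _; rewrite gee0_abs ?lee_fin.
  by rewrite -[LHS](fineK (integrable_fin_num mV i0)) [fine _]a0.
move/(ae_eq_integral_abs mu mV (measurable_int mu i0)).1.
have [_ sa] := Ha; apply: filterS2 sa => x sx h Vx; apply/eqP.
apply: contraT => nz; have [_ _ pd] := hL0; have := pd _ sx nz.
by have [->] := h Vx; rewrite ltxx.
Qed.

Lemma L0_adj a b : pairing (L0a a) b = pairing (L0a b) a.
Proof.
rewrite [RHS]pairingC; apply: eq_Rintegral => x _.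
by apply: tapp_adj; case: hL0.
Qed.

Section green.
Variable Gamma0 : field -> field.
Hypothesis hG : green_operator B L0 Gamma0.

Let residual tau : field := fun x => tapp L0 (Gamma0 tau x) - tau x.

Let HG tau : Hspace B tau -> Hspace B (Gamma0 tau).
Proof. by move=> /hG[[]]. Qed.

Let Hres tau : Hspace B tau -> Hspace B (residual tau).
Proof. by move=> /hG[_ []]. Qed.

Let res_ortho tau e : Hspace B tau -> E0 B e -> pairing (residual tau) e = 0.
Proof. by move=> /hG[_ Sr] Ee; exact: (strain_stress_orthogonal hB hV). Qed.

(** Weak form of the equation that defines the Green operator. *)
Lemma green_pairing tau e : Hspace B tau -> E0 B e ->
  pairing (L0a (Gamma0 tau)) e = pairing tau e.
Proof.
move=> Ht Ee; have He := Ee.1.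
have := pairing_linl 1 (Hres Ht) Ht He.
rewrite mul1r res_ortho// add0r => <-; apply: eq_Rintegral => x _.
by rewrite /lin /residual scale1r subrK.
Qed.

(** The difference [D] of the two sides is a combination of strains, and [L0 D]
    pairs to [0] with every strain by the weak form, hence with [D]; positive
    definiteness gives [D = 0]. *)
Lemma green_lin tau t tau' : Hspace B tau -> Hspace B tau' ->
  field_eq (Gamma0 (lin tau t tau')) (lin (Gamma0 tau) t (Gamma0 tau')).
Proof.
move=> Ht Ht'; have Hl := Hspace_lin t Ht Ht'.
have HGt := HG Ht; have HGt' := HG Ht'; have HGl := HG Hl.
have [Et _] := hG Ht; have [Et' _] := hG Ht'; have [El _] := hG Hl.
pose D := lin (Gamma0 (lin tau t tau')) (-1) (lin (Gamma0 tau) t (Gamma0 tau')).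
have HD : Hspace B D by apply: Hspace_lin => //; exact: Hspace_lin.
have DE e : E0 B e -> pairing (L0a D) e = 0.
  move=> Ee; have He := Ee.1.
  have -> : pairing (L0a D) e = pairing (lin (L0a (Gamma0 (lin tau t tau'))) (-1)
      (lin (L0a (Gamma0 tau)) t (L0a (Gamma0 tau')))) e.
    by apply: eq_Rintegral => x _; rewrite /L0a /D /lin !tappD.
  rewrite pairing_linl ?pairing_linl ?green_pairing ?pairing_linl//; try exact: HL0.
    by ring.
  by apply: Hspace_lin; exact: HL0.
have : pairing (L0a D) D = 0.
  rewrite {2}/D pairing_linr ?pairing_linr//; [|exact: HL0|exact: HL0|exact: Hspace_lin].
  by rewrite !DE//; ring.
move/(pairing_eq0 HD) => D0; rewrite /field_eq; apply: filterS D0 => x.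
rewrite /D /lin scaleN1r => /eqP.
by rewrite subr_eq0 => /eqP.
Qed.

Section functional.
Variable L : 'rV[R]_d -> tensor4 R d.
Hypothesis hL : elasticity_field B V L.

Lemma fapp_adj a b : Hspace B a -> Hspace B b ->
  pairing (fapp L a) b = pairing a (fapp L b).
Proof.
move=> Ha Hb; have HLa := Hspace_fapp hL Ha; have HLb := Hspace_fapp hL Hb.
apply: ae_eq_Rintegral.
- exact: hV.1.
- by apply: measurable_funTS; exact: measurable_ddot.
- by apply: measurable_funTS; exact: measurable_ddot.
- by have [_ _ sL _ _] := hL; apply: filterS sL => x [ms _] _; exact: tapp_adj.
Qed.

(** By linearity of the Green operator, [N (e + t h)] is a quadratic polynomial
    in [t] whose linear coefficient is the scalar product of [A] with
    [G = Gamma0 (L h)]. The weak form for [G] turns it into the pairing of [A]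
    with [L h], the symmetry of [L] into that of [L A] with [h], and the weak form
    for [Gamma0 (L A)] into the claimed scalar product. *)
Lemma Nfun_derivative eps e h : Hspace B eps -> Hspace B e -> E0 B h ->
  let N := Nfun V L0 Gamma0 L eps in
  let A := Gamma0 (fapp L (fun x => eps x + e x)) in
  (fun t : R => (N (fun x => e x + t *: h x) - N e) / t) @ 0^' -->
    inner_He V L0 (Gamma0 (fapp L A)) h.
Proof.
move=> Heps He Eh N A; have Hh := Eh.1.
pose ee x := eps x + e x.
have Hee : Hspace B ee.
  have := Hspace_lin 1 Heps He; congr (Hspace B _).
  by apply/funext => x; rewrite /lin scale1r.
have Ht := Hspace_fapp hL Hee; have Hth := Hspace_fapp hL Hh.
have HA : Hspace B A by exact: HG.
pose G := Gamma0 (fapp L h); have HGh : Hspace B G by exact: HG.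
have EG : E0 B G by have [] := hG Hth.
have EA : E0 B A by have [] := hG Ht.
have HLA := Hspace_fapp hL HA.
pose v := (fine (mu V))^-1.
have NE f : Hspace B f -> 2^-1 * norm_He V L0 f ^+ 2 = 2^-1 * (v * pairing (L0a f) f).
  move=> Hf; rewrite /norm_He sqr_sqrtr ?inner_HeE//.
  by rewrite mulr_ge0 ?pairing_ge0// ltW.
have NtE t : N (fun x => e x + t *: h x) - N e =
    t * (v * pairing (L0a A) G) + t ^+ 2 * (2^-1 * (v * pairing (L0a G) G)).
  have fE : fapp L (fun x => eps x + (e x + t *: h x)) = lin (fapp L ee) t (fapp L h).
    by apply/funext => x; rewrite /fapp /lin addrA tappD.
  have Hl := Hspace_lin t Ht Hth.
  rewrite /N /Nfun fE !NE//; last exact: HG.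
  have gl := green_lin t Ht Hth.
  have HAG : Hspace B (lin A t G) by exact: Hspace_lin.
  have -> : pairing (L0a (Gamma0 (lin (fapp L ee) t (fapp L h))))
      (Gamma0 (lin (fapp L ee) t (fapp L h))) = pairing (L0a (lin A t G)) (lin A t G).
    apply: (pairing_ae _ _ _ _ _ gl) => //; [exact/HL0/HG|exact: HG|exact: HL0|].
    by apply: filterS gl => x; rewrite /L0a => ->.
  rewrite -/A -/G.
  have -> : L0a (lin A t G) = lin (L0a A) t (L0a G).
    by apply/funext => x; rewrite /L0a /lin tappD.
  have HLA0 := HL0 HA; have HLG0 := HL0 HGh.
  rewrite pairing_linl// !pairing_linr//.
  by rewrite (L0_adj G A); field.
have limE : inner_He V L0 (Gamma0 (fapp L A)) h = v * pairing (L0a A) G.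
  rewrite inner_HeE green_pairing// fapp_adj// L0_adj green_pairing//.
  by rewrite pairingC.
rewrite limE.
pose q := 2^-1 * (v * pairing (L0a G) G); pose p := v * pairing (L0a A) G.
(* Off [t = 0] the difference quotient is this affine function of [t]. *)
have c : (fun t : R => p + t * q) @ 0^' --> p.
  rewrite -[X in _ --> X]addr0 -[in X in _ + X](mul0r q).
  apply: cvgD; first exact: cvg_cst.
  apply: cvgMl; exact: nbhs_dnbhs.
apply: cvg_trans c; apply: near_eq_cvg; near=> t.
have t0 : t != 0 by near: t; exact: nbhs_dnbhs_neq.
by rewrite NtE -/p -/q; field.
Unshelve. all: by end_near. Qed.

End functional.
End green.
End reference.
End gradient.

Theorem proposition2 (R : realType) (d : nat)
  (B : 'M[R]_d) (hB : B \in unitmx)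
  (V : set 'rV[R]_d) (hV : unit_cell B V)
  (L0 : tensor4 R d) (hL0 : reference_tensor L0)
  (L : 'rV[R]_d -> tensor4 R d) (hL : elasticity_field B V L)
  (Gamma0 : ('rV[R]_d -> 'M[R]_d) -> ('rV[R]_d -> 'M[R]_d))
  (hGamma0 : green_operator B L0 Gamma0)
  (eps : 'rV[R]_d -> 'M[R]_d) (heps : Ue B eps)
  (e : 'rV[R]_d -> 'M[R]_d) (he : E0 B e) :
  let N := Nfun V L0 Gamma0 L eps in
  let gradN := Gamma0 (fapp L (Gamma0 (fapp L (fun x => eps x + e x)))) in
  is_gradient B V L0 N e gradN /\
  (forall g, is_gradient B V L0 N e g -> field_eq g gradN).
Proof.
move=> N gradN; have Heps := heps.1; have He := he.1.
have Hee : Hspace B (fun x => eps x + e x).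
  have := Hspace_lin 1 Heps He; congr (Hspace B _).
  by apply/funext => x; rewrite /lin scale1r.
have HA := (hGamma0 _ (Hspace_fapp hB hV hL Hee)).1.1.
have Eg : E0 B gradN := (hGamma0 _ (Hspace_fapp hB hV hL HA)).1.
have lim_grad h (Eh : E0 B h) := Nfun_derivative hB hV hL0 hGamma0 hL Heps He Eh.
split; first by split.
(* The difference of two gradients is orthogonal to every strain. *)
move=> g [Egg lim_g].
have Hg := Egg.1; have Hgr := Eg.1.
have inner_eq h : E0 B h -> inner_He V L0 g h = inner_He V L0 gradN h.
  by move=> Eh; apply: cvg_unique (lim_g h Eh) (lim_grad h Eh).
have [HL HLg] : Hspace B (fun x => tapp L0 (g x)) /\ Hspace B (fun x => tapp L0 (gradN x)).
  by split; apply: Hspace_tapp => //; case: hL0.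
have v0 : (fine (lebesgue_rV R d V))^-1 != 0.
  by rewrite invr_eq0 gt_eqF// fine_gt0// (cell_gt0 hB hV) (cell_lty hB hV).
pose D := lin g (-1) gradN; have HD : Hspace B D by exact: Hspace_lin.
have DE h : E0 B h -> pairing V (fun x => tapp L0 (D x)) h = 0.
  move=> Eh; have Hh := Eh.1; have := inner_eq h Eh.
  have -> : (fun x => tapp L0 (D x)) =
      lin (fun x => tapp L0 (g x)) (-1) (fun x => tapp L0 (gradN x)).
    by apply/funext => x; rewrite /D /lin tappD.
  rewrite (pairing_linl hB hV)// /inner_He /average => /(mulfI v0).
  by rewrite /pairing => ->; ring.
have : pairing V (fun x => tapp L0 (D x)) D = 0.
  rewrite {2}/D (pairing_linr hB hV)//; last by apply: Hspace_tapp => //; case: hL0.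
  by rewrite !DE//; ring.
move/(pairing_eq0 hB hV hL0 HD); move=> D0; rewrite /field_eq; apply: filterS D0 => x.
by rewrite /D /lin scaleN1r => /eqP; rewrite subr_eq0 => /eqP.
Qed.
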